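(* Let $V\in C^2(\mathbb{R},\mathbb{R})$ satisfy $V(x)\ge0$ for all $x$, $V(-1)=V(1)=0$, $V(x)>0$ for $x\in(-1,1)$, and $V''(-1),V''(1)>0$. Let $a:\mathbb{R}\to\mathbb{R}$ be bounded and continuous with $\liminf_{|t|\to\infty}a(t)=a_\infty>\inf_{t\in\mathbb{R}}a(t)=a(0)>0$. Then there is $\epsilon^*>0$ such that for all $\epsilon\in(0,\epsilon^* )$ the problem $\ddot x(t)=a(\epsilon t)V'(x(t))$, $t\in\mathbb{R}$, $x(t)\to-1$ as $t\to-\infty$, $x(t)\to1$ as $t\to+\infty$, has a solution $x\in H^1_{loc}(\mathbb{R})\cap C^2(\mathbb{R})$. Moreover, $x(t)\in(-1,1)$ for all $t\in\mathbb{R}$. *)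

(* Defs.v *)
From Stdlib Require Import Reals.
From Coquelicot Require Import Coquelicot.
Open Scope R_scope.

Definition C2 (f : R -> R) : Prop :=
  forall x, ex_derive f x /\ ex_derive (Derive f) x /\
            continuous (Derive_n f 2) x.

Definition bounded_fun (f : R -> R) : Prop :=
  exists M, forall t, Rabs (f t) <= M.

Definition liminf_abs_infty (f : R -> R) (l : R) : Prop :=
  (forall e, 0 < e -> exists M, forall t, M <= Rabs t -> l - e <= f t) /\
  (forall e, 0 < e -> forall M, exists t, M <= Rabs t /\ f t <= l + e).

Definition H1loc (x : R -> R) : Prop :=
  forall a b, ex_RInt (fun t => (x t)^2) a b /\
              ex_RInt (fun t => (Derive x t)^2) a b.

(* Main.v *)
(** Discretise the action [sum ((x_{i+1} - x_i)^2 / 2h + h a(eps t_i) V(x_i))] over paths in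
    [[-1,1]] from [-1] to [1] on a long grid. Its minimisers solve the discrete Euler-Lagrange
    equation exactly, and localisation of the transition follows from energy counting alone.
    With [W' = sqrt (2V)] and [w = W 1 - W (-1)], a competitor crossing where [a] is close to
    [a 0] costs about [sqrt (a 0) * w] once [eps] is small. A path already away from [-1] at a
    time far to the left must afterwards either return near [-1] and start again, which costs a
    fixed amount more than [sqrt (a 0) * w], or complete the transition where [a] is bounded
    below by some [a1 > a 0], which costs about [sqrt a1 * w], or linger where [V] is bounded
    below; the same holds far to the right. So the transition stays in a fixed time window as
    the grid gets finer and longer, and pointwise limits of the minimisers along an ultrafilter
    solve the equation. Near [-1] and [1] the limit is convex, respectively concave, which gives
    its limits at infinity; contact with [-1] or [1] is excluded by uniqueness. *)

Require Import Defs.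
From Stdlib Require Import Reals Lra Lia ZArith ClassicalChoice.
From Coquelicot Require Import Coquelicot.
From mathcomp Require classical.filter.
Open Scope R_scope.

(** * Ultralimits and discrete minimisers *)

(** The danger is loss of compactness: the transition may drift off along the approximation and
    leave a constant as limit. Only the gap between [a 0] and [a_inf] prevents this, and smallness
    of [eps] has one purpose: a nearly optimal transition, whose duration is fixed before [eps],
    must take place while [a (eps * t)] is close to [a 0]. The limit is not claimed to minimise
    anything. Only the equation and pointwise bounds pass to it, so neither semicontinuity of the
    action nor a function space is involved. Confining paths to [[-1,1]] makes the minimisation
    compact, and it does not disturb the equation because [V'] vanishes at both wells. The natural
    weight [sqrt (2 * V)] may fail to be differentiable at the wells and vanishes there. Both energy
    bounds therefore use a smooth function within [s] of it; its second-order Taylor remainder costs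
    a term of order [h], absorbed by refining the grid, and the added [s] lets the competitor arrive
    in finite time. *)

Definition ultrafilter_nat (F : (nat -> Prop) -> Prop) : Prop :=
  ProperFilter F /\ (forall P, F P \/ F (fun n => ~ P n)) /\
  (forall P, eventually P -> F P).

(** The ultrafilter extends the filter of eventual properties, hence is nonprincipal: limits along
    it ignore finitely many indices. *)
Lemma ultrafilter_nat_exists : exists F, ultrafilter_nat F.
Proof.
  assert (HP : @filter.ProperFilter nat eventually).
  { split.
    - intros [N HN]. exact (HN N (le_n N)).
    - split.
      + exists 0%nat. intros; exact I.
      + intros P Q HP HQ. exact (filter_and P Q HP HQ).
      + intros P Q H. exact (filter_imp P Q H). }
  destruct (filter.ultraFilterLemma HP) as [F [HF Hsub]].
  exists F. split; [|split].
  - assert (HpF := @filter.ultra_proper nat F HF).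
    constructor.
    + intros P HP'. destruct (classic (exists x, P x)) as [|Hn]; [assumption|].
      exfalso. apply (filter.filter_not_empty F).
      refine (@filter.filterS nat F _ P _ _ HP').
      intros x Hx. apply Hn. exists x. exact Hx.
    + constructor.
      * exact filter.filterT.
      * intros P Q HP' HQ. exact (filter.filterI HP' HQ).
      * intros P Q H. exact (@filter.filterS nat F _ P Q H).
  - intros P. exact (@filter.in_ultra_setVsetC nat F P HF).
  - intros P HP'. exact (Hsub P HP').
Qed.

(** The limit is the supremum of the levels that [u] reaches on an [F]-large set. A level slightly
    above it is not reached on such a set, and the dichotomy turns this into an upper bound for [u]
    on one. *)
Lemma ultralimit_exists F (u : nat -> R) M :
  ultrafilter_nat F -> F (fun n => Rabs (u n) <= M) ->
  exists l, filterlim u F (locally l).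
Proof.
  intros [HF [Hu He]] Hb.
  destruct (completeness (fun y => F (fun n => y <= u n))) as [l [Hl1 Hl2]].
  - exists M. intros y Hy.
    destruct (filter_ex _ (filter_and _ _ Hy Hb)) as [n [H1 H2]].
    apply Rabs_le_between in H2. lra.
  - exists (-M). revert Hb. apply filter_imp. intros n H.
    apply Rabs_le_between in H. lra.
  - exists l. apply filterlim_locally. intros eps.
    destruct (Hu (fun n => l + eps / 2 <= u n)) as [H|H].
    { specialize (Hl1 _ H). destruct eps; simpl in *; lra. }
    assert (H' : exists y, l - eps < y /\ F (fun n => y <= u n)).
    { apply NNPP. intros Hn. assert (l <= l - eps).
      { apply Hl2. intros y Hy. apply Rnot_lt_le. intros Hlt. apply Hn. exists y; tauto. }
      destruct eps; simpl in *; lra. }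
    destruct H' as [y [Hy1 Hy2]].
    generalize (filter_and _ _ H Hy2). apply filter_imp. intros n [A1 A2].
    apply Rabs_lt_between'. destruct eps; simpl in *. split; lra.
Qed.

Lemma ultralimit_near F {FF : Filter F} (u : nat -> R) l e :
  filterlim u F (locally l) -> 0 < e -> F (fun n => Rabs (u n - l) < e).
Proof.
  intros H He. exact (proj1 (filterlim_locally u l) H (mkposreal e He)).
Qed.

Lemma ultralimit_le F {FF : ProperFilter F} (u : nat -> R) l c :
  filterlim u F (locally l) ->
  (forall e, 0 < e -> F (fun n => u n <= c + e)) -> l <= c.
Proof.
  intros H Hc. apply Rle_plus_epsilon. intros e He.
  assert (He2 : 0 < e / 2) by lra.
  destruct (filter_ex _ (filter_and _ _ (ultralimit_near F u l _ H He2) (Hc _ He2)))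
    as [n [H1 H2]].
  apply Rabs_lt_between' in H1. lra.
Qed.

(** A prefix sum, so that the cost of the steps from [p] to [q] is a difference of two values. The
    potential is sampled at the left end of each step. *)
Fixpoint action (h : R) (b : nat -> R) (V : R -> R) (x : nat -> R) (n : nat) : R :=
  match n with
  | O => 0
  | S i => action h b V x i + ((x (S i) - x i) ^ 2 / (2 * h) + h * b i * V (x i))
  end.

(** The bound covers all indices, also those past [N], so that later estimates carry no index
    condition for it. *)
Definition admissible (N : nat) (x : nat -> R) : Prop :=
  x O = -1 /\ x N = 1 /\ forall i, -1 <= x i <= 1.

Lemma action_ext h b V x y n :
  (forall i, (i <= n)%nat -> x i = y i) -> action h b V x n = action h b V y n.
Proof.
  induction n; intros H; simpl; [reflexivity|].
  rewrite IHn by (intros; apply H; lia).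
  rewrite (H n), (H (S n)) by lia. reflexivity.
Qed.

Lemma action_le h b V x p q :
  0 < h -> (forall i, 0 <= b i) -> (forall y, 0 <= V y) -> (p <= q)%nat ->
  action h b V x p <= action h b V x q.
Proof.
  intros Hh Hb HV Hpq. induction Hpq; [lra|]. simpl.
  assert (0 <= (x (S m) - x m) ^ 2 / (2 * h)).
  { apply Rdiv_le_0_compat; [apply pow2_ge_0|lra]. }
  assert (0 <= h * b m * V (x m)).
  { apply Rmult_le_pos; [apply Rmult_le_pos; [lra|apply Hb]|apply HV]. }
  lra.
Qed.

Lemma action_filterlim F {FF : Filter F} h b V (X : nat -> nat -> R) x n :
  (forall y, continuous V y) ->
  (forall i, filterlim (fun k => X k i) F (locally (x i))) ->
  filterlim (fun k => action h b V (X k) n) F (locally (action h b V x n)).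
Proof.
  intros HV HX. induction n; simpl.
  - apply filterlim_const.
  - apply (filterlim_comp_2 (G := locally (action h b V x n))
      (H := locally ((x (S n) - x n) ^ 2 / (2 * h) + h * b n * V (x n)))
      _ _ Rplus IHn);
      [|apply (filterlim_plus (action h b V x n)
          ((x (S n) - x n) ^ 2 / (2 * h) + h * b n * V (x n)))].
    apply (filterlim_comp_2 (G := locally ((x (S n) - x n) ^ 2 / (2 * h)))
      (H := locally (h * b n * V (x n))) _ _ Rplus);
      [| |apply (filterlim_plus ((x (S n) - x n) ^ 2 / (2 * h)) (h * b n * V (x n)))].
    + apply (filterlim_comp _ _ _ (fun k => X k (S n) - X k n)
        (fun d => d ^ 2 / (2 * h)) _ (locally (x (S n) - x n))).
      * apply (filterlim_comp_2 (G := locally (x (S n))) (H := locally (- x n))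
          _ (fun k => - X k n) Rplus (HX _));
          [|apply (filterlim_plus (x (S n)) (- x n))].
        apply (filterlim_comp _ _ _ (fun k => X k n) Ropp _ (locally (x n)));
          [apply HX|apply (filterlim_opp (x n))].
      * apply (ex_derive_continuous (fun d : R => d ^ 2 / (2 * h))).
        apply (ex_derive_ext (fun d => d ^ 2 * / (2 * h))); [reflexivity|].
        auto_derive. trivial.
    + apply (filterlim_comp _ _ _ (fun k => X k n)
        (fun d => h * b n * V d) _ (locally (x n))); [apply HX|].
      apply (continuous_mult (fun _ => h * b n) V); [apply continuous_const|apply HV].
Qed.

(** Direct method in finitely many coordinates: the coordinatewise ultralimit of a minimising
    sequence keeps the constraints, and the action of [N] steps is continuous in the coordinates. *)
Lemma minimizer_exists h b V N :
  0 < h -> (forall i, 0 <= b i) -> (forall y, 0 <= V y) ->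
  (forall y, continuous V y) -> (0 < N)%nat ->
  exists x, admissible N x /\
    forall y, admissible N y -> action h b V x N <= action h b V y N.
Proof.
  intros Hh Hb HV HVc HN.
  destruct ultrafilter_nat_exists as [F HF].
  (* [completeness] yields suprema, so the infimum of the action appears as [- l]. *)
  destruct (completeness (fun r => exists y, admissible N y /\ r = - action h b V y N))
    as [l [Hl1 Hl2]].
  - exists 0. intros r [y [_ ->]].
    generalize (action_le h b V y 0 N Hh Hb HV (Nat.le_0_l N)). simpl. lra.
  - exists (- action h b V (fun i => if Nat.eqb i 0 then -1 else 1) N).
    exists (fun i => if Nat.eqb i 0 then -1 else 1). split; [|reflexivity].
    split; [reflexivity|]. split.
    + destruct N; [lia|reflexivity].
    + intros i. destruct (Nat.eqb i 0); lra.
  - assert (H : forall n, exists y, admissible N y /\ action h b V y N < - l + / INR (S n)).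
    { intros n. apply NNPP. intros Hn.
      assert (0 < / INR (S n)) by (apply Rinv_0_lt_compat, lt_0_INR; lia).
      assert (l <= l - / INR (S n)); [|lra].
      apply Hl2. intros r [y [Hy ->]]. apply Rnot_lt_le. intros Hlt. apply Hn.
      exists y. split; [assumption|lra]. }
    apply choice in H. destruct H as [X HX].
    assert (Hx : forall i, exists z, filterlim (fun k => X k i) F (locally z)).
    { intros i. apply ultralimit_exists with 1; [assumption|].
      apply HF. exists 0%nat. intros n _. apply Rabs_le_between.
      apply (proj1 (HX n)). }
    apply choice in Hx. destruct Hx as [x Hx].
    destruct HF as [FF [Hu He]].
    assert (Heq : forall i c, (forall k, X k i = c) -> x i = c).
    { intros i c Hc. apply (filterlim_locally_unique (F := F) (fun k => X k i)); [apply Hx|].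
      apply filterlim_ext with (fun _ => c); [intros; symmetry; apply Hc|].
      apply filterlim_const. }
    exists x. split.
    + split; [apply Heq; intros; apply HX|]. split; [apply Heq; intros; apply HX|].
      intros i. split.
      * assert (- x i <= 1); [|lra].
        apply (ultralimit_le F (fun k => - X k i)).
        -- apply (filterlim_comp _ _ _ (fun k => X k i) Ropp _ (locally (x i)));
             [apply Hx|apply (filterlim_opp (x i))].
        -- intros e He'. apply He. exists 0%nat. intros n _.
           destruct (proj1 (HX n)) as [_ [_ H]]. specialize (H i). lra.
      * apply (ultralimit_le F (fun k => X k i)); [apply Hx|].
        intros e He'. apply He. exists 0%nat. intros n _.
        destruct (proj1 (HX n)) as [_ [_ H]]. specialize (H i). lra.
    + intros y Hy. apply Rle_trans with (- l).
      * apply (ultralimit_le F (fun k => action h b V (X k) N)).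
        -- apply action_filterlim; [apply FF|assumption|assumption].
        -- intros e He'. apply He.
           destruct (nfloor_ex (/ e)) as [m [_ Hm]].
           { left. now apply Rinv_0_lt_compat. }
           exists m. intros n Hn. destruct (HX n) as [_ Hlt].
           assert (/ INR (S n) <= e); [|lra].
           rewrite <- (Rinv_inv e). apply Rinv_le_contravar; [now apply Rinv_0_lt_compat|].
           apply le_INR in Hn. rewrite S_INR. lra.
      * assert (- action h b V y N <= l); [|lra].
        apply Hl1. exists y. tauto.
Qed.

(** * Discrete Euler-Lagrange equation *)

Lemma derive_ge0_at_right_min f x l d :
  is_derive f x l -> 0 < d -> (forall z, x < z < x + d -> f x <= f z) -> 0 <= l.
Proof.
  intros Hf Hd Hm. apply Rnot_lt_le. intros Hl.
  apply is_derive_Reals in Hf.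
  destruct (Hf (- l) ltac:(lra)) as [del Hdel].
  set (k := Rmin (del / 2) (d / 2)).
  assert (Hk : 0 < k /\ k <= del / 2 /\ k <= d / 2).
  { unfold k. split; [|split; [apply Rmin_l|apply Rmin_r]].
    destruct del; simpl. apply Rmin_pos; lra. }
  specialize (Hdel k ltac:(lra)).
  assert (Rabs k < del) by (rewrite Rabs_pos_eq; destruct del; simpl in *; lra).
  specialize (Hdel H). apply Rabs_lt_between' in Hdel.
  specialize (Hm (x + k) ltac:(lra)).
  assert (0 <= (f (x + k) - f x) / k) by (apply Rdiv_le_0_compat; lra).
  lra.
Qed.

Lemma derive_le0_at_left_min f x l d :
  is_derive f x l -> 0 < d -> (forall z, x - d < z < x -> f x <= f z) -> l <= 0.
Proof.
  intros Hf Hd Hm.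
  assert (0 <= - l); [|lra].
  apply derive_ge0_at_right_min with (fun z => f (- z)) (- x) d; [|assumption|].
  - replace (- l) with (scal (-1) l) by (unfold scal; simpl; unfold mult; simpl; ring).
    apply (is_derive_comp f Ropp).
    + now rewrite Ropp_involutive.
    + auto_derive; trivial; ring.
  - intros z Hz. rewrite Ropp_involutive. apply Hm. lra.
Qed.

Lemma derive_eq0_at_min f x l :
  is_derive f x l -> (forall z, f x <= f z) -> l = 0.
Proof.
  intros Hf Hm. apply Rle_antisym.
  - apply derive_le0_at_left_min with f x 1; auto; lra.
  - apply derive_ge0_at_right_min with f x 1; auto; lra.
Qed.

Lemma action_update h b V x i z N :
  (S (S i) <= N)%nat ->
  action h b V (fun j => if Nat.eqb j (S i) then z else x j) N - action h b V x N =
  ((x (S (S i)) - z) ^ 2 / (2 * h) + (z - x i) ^ 2 / (2 * h) + h * b (S i) * V z) -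
  ((x (S (S i)) - x (S i)) ^ 2 / (2 * h) + (x (S i) - x i) ^ 2 / (2 * h)
     + h * b (S i) * V (x (S i))).
Proof.
  intros HN. induction HN as [|N HN IH].
  - cbn [action]. rewrite (action_ext h b V _ x i).
    + replace (Nat.eqb (S (S i)) (S i)) with false by (symmetry; apply Nat.eqb_neq; lia).
      replace (Nat.eqb i (S i)) with false by (symmetry; apply Nat.eqb_neq; lia).
      rewrite Nat.eqb_refl. ring.
    + intros j Hj. replace (Nat.eqb j (S i)) with false; [reflexivity|].
      symmetry; apply Nat.eqb_neq; lia.
  - cbn [action]. rewrite <- IH.
    replace (Nat.eqb (S N) (S i)) with false by (symmetry; apply Nat.eqb_neq; lia).
    replace (Nat.eqb N (S i)) with false by (symmetry; apply Nat.eqb_neq; lia).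
    ring.
Qed.

(* At a contact point [x (S i) = 1] or [x (S i) = -1] the one-sided minimality
   condition and the convexity of the constraint give opposite inequalities,
   because [V'] vanishes there. *)
Lemma discrete_euler_lagrange h b V x N i :
  0 < h -> (forall y, ex_derive V y) -> (forall y, 0 <= V y) -> V (-1) = 0 -> V 1 = 0 ->
  admissible N x ->
  (forall y, admissible N y -> action h b V x N <= action h b V y N) ->
  (S i < N)%nat ->
  x (S (S i)) - 2 * x (S i) + x i = h ^ 2 * (b (S i) * Derive V (x (S i))).
Proof.
  intros Hh HdV HV HV1 HV2 [Hx0 [HxN Hx]] Hmin Hi.
  set (phi := fun z => (x (S (S i)) - z) ^ 2 / (2 * h) + (z - x i) ^ 2 / (2 * h)
                         + h * b (S i) * V z).
  set (l := - (x (S (S i)) - 2 * x (S i) + x i) / h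
              + h * (b (S i) * Derive V (x (S i)))).
  assert (Hphi : is_derive phi (x (S i)) l).
  { unfold phi, l. auto_derive; [apply HdV|].
    change (Derive (fun z => V z)) with (Derive V). field. lra. }
  assert (Hle : forall z, -1 <= z <= 1 -> phi (x (S i)) <= phi z).
  { intros z Hz. generalize (action_update h b V x i z N Hi). fold (phi z) (phi (x (S i))).
    intros Heq. assert (action h b V x N
      <= action h b V (fun j => if Nat.eqb j (S i) then z else x j) N); [|lra].
    apply Hmin. split; [|split].
    - exact Hx0.
    - replace (Nat.eqb N (S i)) with false; [exact HxN|]. symmetry; apply Nat.eqb_neq; lia.
    - intros j. destruct (Nat.eqb j (S i)); [exact Hz|apply Hx]. }
  assert (Hcrit : forall p, V p = 0 -> Derive V p = 0).
  { intros p Hp. apply (derive_eq0_at_min V p); [apply Derive_correct, HdV|].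
    intros z. rewrite Hp. apply HV. }
  assert (Hs : forall z, 0 <= z -> 0 <= z / h) by (intros; apply Rdiv_le_0_compat; lra).
  assert (Hl : l = 0).
  { pose proof (Hx i) as H1. pose proof (Hx (S i)) as H2. pose proof (Hx (S (S i))) as H3.
    apply Rle_antisym.
    - destruct (Req_dec (x (S i)) (-1)) as [He|He].
      + unfold l. rewrite He, (Hcrit _ HV1).
        specialize (Hs (x (S (S i)) - 2 * -1 + x i) ltac:(lra)).
        unfold Rdiv in *. lra.
      + apply derive_le0_at_left_min with phi (x (S i)) (x (S i) + 1); [assumption|lra|].
        intros z Hz. apply Hle. lra.
    - destruct (Req_dec (x (S i)) 1) as [He|He].
      + unfold l. rewrite He, (Hcrit _ HV2).
        specialize (Hs (- (x (S (S i)) - 2 * 1 + x i)) ltac:(lra)).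
        unfold Rdiv in *. lra.
      + apply derive_ge0_at_right_min with phi (x (S i)) (1 - x (S i)); [assumption|lra|].
        intros z Hz. apply Hle. lra. }
  unfold l in Hl.
  apply Rmult_eq_reg_l with (/ h); [|apply Rinv_neq_0_compat; lra].
  replace (/ h * (h ^ 2 * (b (S i) * Derive V (x (S i)))))
    with (h * (b (S i) * Derive V (x (S i)))) by (field; lra).
  unfold Rdiv in Hl. lra.
Qed.

(** * Lower bound for the action *)

Lemma mean_value f df x y :
  (forall z, is_derive f z (df z)) ->
  exists c, Rmin x y <= c <= Rmax x y /\ f y - f x = df c * (y - x).
Proof.
  intros H. apply MVT_gen; intros z _; [apply H|].
  apply continuity_pt_filterlim, (ex_derive_continuous f). eexists; apply H.
Qed.

Lemma increment_le f df g dg x y :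
  (forall z, is_derive f z (df z)) -> (forall z, is_derive g z (dg z)) ->
  x <= y -> (forall z, x <= z <= y -> df z <= dg z) -> f y - f x <= g y - g x.
Proof.
  intros Hf Hg Hxy Hle.
  destruct (mean_value (fun z => g z - f z) (fun z => dg z - df z) x y) as [c [Hc Heq]].
  - intros z. apply (is_derive_minus g f); auto.
  - rewrite Rmin_left, Rmax_right in Hc by assumption. specialize (Hle c Hc).
    assert (0 <= (dg c - df c) * (y - x)) by (apply Rmult_le_pos; lra). lra.
Qed.

Lemma continuous_bounded f a b :
  (forall x, continuous f x) ->
  exists B, 0 <= B /\ forall x, a <= x <= b -> Rabs (f x) <= B.
Proof.
  intros Hf. destruct (Rle_lt_dec a b) as [Hab|Hab].
  - destruct (continuity_ab_maj (fun x => Rabs (f x)) a b Hab) as [M [HM _]].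
    + intros c _. apply continuity_pt_filterlim.
      apply (continuous_comp f Rabs); [apply Hf|apply continuous_Rabs].
    + exists (Rabs (f M)). split; [apply Rabs_pos|exact HM].
  - exists 0. split; [lra|]. intros; lra.
Qed.

Lemma lipschitz_on (f : R -> R) a b :
  (forall x, ex_derive f x) -> (forall x, continuous (Derive f) x) ->
  exists K, 0 <= K /\ forall x y, a <= x <= b -> a <= y <= b ->
    Rabs (f y - f x) <= K * Rabs (y - x).
Proof.
  intros Hd Hc. destruct (continuous_bounded (Derive f) a b Hc) as [K [HK HB]].
  exists K. split; [assumption|]. intros x y Hx Hy.
  destruct (mean_value f (Derive f) x y) as [c [Hcc ->]].
  - intros z. apply Derive_correct, Hd.
  - rewrite Rabs_mult. apply Rmult_le_compat_r; [apply Rabs_pos|]. apply HB.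
    unfold Rmin, Rmax in Hcc. destruct (Rle_dec x y); lra.
Qed.

(* [sqrt (2 V)] need not be differentiable where [V] vanishes;
   [sqrt (2 V + s^2) - s] is a smooth function within [s] below it. *)
Lemma smooth_calibration (V : R -> R) s :
  (forall x, ex_derive V x) -> (forall x, continuous (Derive V) x) ->
  (forall x, 0 <= V x) -> 0 < s ->
  exists g Gam K, 0 <= K /\
    (forall x, 0 <= g x /\ g x ^ 2 <= 2 * V x <= (g x + s) ^ 2) /\
    (forall x, -1 <= x <= 1 -> g x <= K) /\
    (forall x, is_derive Gam x (g x)) /\
    (forall x y, -1 <= x <= 1 -> -1 <= y <= 1 ->
       Rabs (Gam y - Gam x - g x * (y - x)) <= K * (y - x) ^ 2).
Proof.
  intros Hd Hc HV Hs.
  assert (Hpos : forall x, 0 < 2 * V x + s ^ 2).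
  { intros x. specialize (HV x). nra. }
  set (g := fun x => sqrt (2 * V x + s ^ 2) - s).
  assert (Hg : forall x, is_derive g x (Derive V x / sqrt (2 * V x + s ^ 2))).
  { intros x. unfold g. auto_derive.
    - split; [apply Hd|]. split; [|trivial]. specialize (Hpos x). simpl in Hpos. lra.
    - change (Derive (fun z => V z) x) with (Derive V x).
      replace (s * (s * 1)) with (s ^ 2) by ring. field.
      apply Rgt_not_eq, sqrt_lt_R0, Hpos. }
  assert (Hgc : forall x, continuous g x).
  { intros x. apply (ex_derive_continuous g). eexists; apply Hg. }
  assert (HdVc : forall x, continuous (Derive g) x).
  { intros x. apply continuous_ext with (fun x => Derive V x * / sqrt (2 * V x + s ^ 2)).
    - intros y. symmetry. apply is_derive_unique, Hg.
    - apply (continuous_mult (Derive V)); [apply Hc|].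
      apply (ex_derive_continuous (fun x => / sqrt (2 * V x + s ^ 2))).
      auto_derive. replace (s * (s * 1)) with (s ^ 2) by ring.
      repeat split; try apply Hd; try apply Hpos.
      apply Rgt_not_eq, sqrt_lt_R0, Hpos. }
  destruct (lipschitz_on g (-1) 1) as [K [HK HL]]; [eexists; apply Hg|assumption|].
  destruct (continuous_bounded g (-1) 1 Hgc) as [B [HB HgB]].
  set (Gam := fun x => RInt g 0 x).
  assert (HG : forall x, is_derive Gam x (g x)).
  { intros x. apply is_derive_RInt with 0; [|apply Hgc].
    exists (mkposreal 1 Rlt_0_1). intros y _. apply RInt_correct.
    apply ex_RInt_continuous. intros; apply Hgc. }
  (* [K] is a Lipschitz constant of [g] on [[-1,1]] and [B] a bound for it there; the sum serves
     both purposes. *)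
  exists g, Gam, (K + B). split; [lra|]. split; [|split; [|split; [exact HG|]]].
  - intros x. unfold g.
    assert (Hsq : sqrt (2 * V x + s ^ 2) ^ 2 = 2 * V x + s ^ 2).
    { apply pow2_sqrt. left; apply Hpos. }
    assert (Hge : s <= sqrt (2 * V x + s ^ 2)).
    { rewrite <- (sqrt_pow2 s) at 1 by lra. apply sqrt_le_1_alt.
      specialize (HV x). lra. }
    specialize (HV x). split; [lra|]. split; nra.
  - intros x Hx. specialize (HgB x Hx). apply Rabs_le_between in HgB. lra.
  - intros x y Hx Hy.
    destruct (mean_value Gam g x y HG) as [c [Hcc ->]].
    replace (g c * (y - x) - g x * (y - x)) with ((g c - g x) * (y - x)) by ring.
    rewrite Rabs_mult.
    assert (Hcx : Rabs (c - x) <= Rabs (y - x) /\ -1 <= c <= 1).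
    { unfold Rmin, Rmax in Hcc. destruct (Rle_dec x y).
      - rewrite !Rabs_pos_eq; lra.
      - rewrite !Rabs_left1; lra. }
    specialize (HL x c Hx (proj2 Hcx)).
    rewrite <- (pow2_abs (y - x)).
    pose proof (Rabs_pos (y - x)). pose proof (Rabs_pos (c - x)).
    assert (Rabs (g c - g x) <= (K + B) * Rabs (y - x)).
    { apply Rle_trans with (1 := HL). apply Rmult_le_compat; lra. }
    nra.
Qed.

(* Each step costs at least [sqrt beta * g * |step|] by AM-GM. *)
Lemma action_lower_bound (V W : R -> R) s :
  (forall x, ex_derive V x) -> (forall x, continuous (Derive V) x) ->
  (forall x, 0 <= V x) -> (forall x, is_derive W x (sqrt (2 * V x))) -> 0 < s ->
  exists C, 0 <= C /\ forall h b x beta p q,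
    0 < h -> 0 <= beta -> (forall i, -1 <= x i <= 1) -> (p <= q)%nat ->
    (forall i, (p <= i < q)%nat -> beta <= b i) ->
    sqrt beta * (W (x q) - W (x p) - 2 * s
                 - C * h * (action h b V x q - action h b V x p))
      <= action h b V x q - action h b V x p.
Proof.
  intros Hd Hc HV HW Hs.
  destruct (smooth_calibration V s Hd Hc HV Hs) as [g [Gam [K [HK [Hg [_ [HG HT]]]]]]].
  (* The Taylor remainder of [Gam] over a step [D] of cost [e] is at most [K * D ^ 2], and
     [D ^ 2 <= 2 * h * e]. The errors thus add up to [2 * K * h] times the action itself. *)
  exists (2 * K). split; [lra|]. intros h b x beta p q Hh Hbeta Hx Hpq Hb.
  assert (Hsb := sqrt_pos beta). assert (Hsq := pow2_sqrt beta Hbeta).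
  set (r := sqrt beta) in *.
  assert (H : r * (Gam (x q) - Gam (x p)
                   - 2 * K * h * (action h b V x q - action h b V x p))
      <= action h b V x q - action h b V x p).
  { induction Hpq as [|q Hpq IH].
    - apply Req_le. ring.
    - specialize (IH ltac:(intros; apply Hb; lia)). cbn [action].
      set (D := x (S q) - x q). set (e := D ^ 2 / (2 * h) + h * b q * V (x q)).
      assert (He : r * (Gam (x (S q)) - Gam (x q) - 2 * K * h * e) <= e).
      { assert (Hdef : e = D ^ 2 / (2 * h) + h * b q * V (x q)) by reflexivity.
        assert (HhV : h * (r ^ 2 * (g (x q) ^ 2 / 2)) <= h * b q * V (x q)).
        { rewrite Rmult_assoc. apply Rmult_le_compat_l; [lra|].
          apply Rmult_le_compat; [apply pow2_ge_0| |rewrite Hsq; apply Hb; lia|].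
          - pose proof (pow2_ge_0 (g (x q))). lra.
          - destruct (Hg (x q)) as [_ [H1 _]]. lra. }
        assert (HD : D ^ 2 <= 2 * h * e).
        { assert (0 <= h * (r ^ 2 * (g (x q) ^ 2 / 2))).
          { apply Rmult_le_pos; [lra|]. apply Rmult_le_pos; [apply pow2_ge_0|].
            pose proof (pow2_ge_0 (g (x q))). lra. }
          replace (D ^ 2) with (2 * h * (D ^ 2 / (2 * h))) by (field; lra).
          apply Rmult_le_compat_l; lra. }
        specialize (HT (x q) (x (S q)) (Hx _) (Hx _)). fold D in HT.
        apply Rabs_le_between in HT.
        assert (HAG : r * (g (x q) * D) <= e).
        { assert (0 <= (D / h - r * g (x q)) ^ 2 * (h / 2)).
          { apply Rmult_le_pos; [apply pow2_ge_0|lra]. }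
          replace ((D / h - r * g (x q)) ^ 2 * (h / 2)) with
            (D ^ 2 / (2 * h) + h * (r ^ 2 * (g (x q) ^ 2 / 2)) - r * (g (x q) * D))
            in H by (field; lra). lra. }
        apply Rle_trans with (2 := HAG). apply Rmult_le_compat_l; [assumption|].
        assert (K * D ^ 2 <= K * (2 * h * e)) by (apply Rmult_le_compat_l; lra). lra. }
      replace (action h b V x q + e - action h b V x p)
        with ((action h b V x q - action h b V x p) + e) by ring. nra. }
  apply Rle_trans with (2 := H). apply Rmult_le_compat_l; [assumption|].
  assert (Hgs : forall z, g z <= sqrt (2 * V z) <= g z + s).
  { intros z. destruct (Hg z) as [H1 [H2 H3]]. split.
    - rewrite <- (sqrt_pow2 (g z)) by assumption. now apply sqrt_le_1_alt.
    - rewrite <- (sqrt_pow2 (g z + s)) by lra. now apply sqrt_le_1_alt. }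
  (* The derivatives of [W] and [Gam] differ by at most [s] on an interval of length [2]. For a
     decreasing pair of values the sign of the difference is favourable and nothing is lost. *)
  assert (W (x q) - W (x p) - 2 * s <= Gam (x q) - Gam (x p)); [|lra].
  destruct (Rle_lt_dec (x p) (x q)) as [Hle|Hlt].
  - generalize (increment_le W (fun z => sqrt (2 * V z)) (fun z => Gam z + s * z)
      (fun z => g z + s) (x p) (x q) HW).
    intros Hi.
    specialize (Hi ltac:(intros z;
      apply (is_derive_plus Gam (fun z => s * z) z (g z) s);
        [apply HG|auto_derive; trivial; ring])).
    specialize (Hi Hle ltac:(intros; apply Hgs)). simpl in Hi.
    pose proof (Hx p). pose proof (Hx q). nra.
  - generalize (increment_le Gam g W (fun z => sqrt (2 * V z)) (x q) (x p) HG HW).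
    intros Hi. specialize (Hi ltac:(lra) ltac:(intros; apply Hgs)). lra.
Qed.

(** * Competitor and localisation *)

(* Euler scheme for [y' = G y] stopped at [1]; with [G = sqrt A * (g + s)] kinetic and
   potential energy are nearly equal along it, so it is almost optimal. *)
Fixpoint truncated_euler (h : R) (G : R -> R) (n : nat) : R :=
  match n with
  | O => -1
  | S m => Rmin 1 (truncated_euler h G m + h * G (truncated_euler h G m))
  end.

Lemma truncated_euler_bounds h G n :
  0 <= h -> (forall x, 0 <= G x) -> -1 <= truncated_euler h G n <= 1.
Proof.
  intros Hh HG. induction n; simpl; [lra|].
  split; [|apply Rmin_l]. apply Rmin_glb; [lra|].
  assert (0 <= h * G (truncated_euler h G n)) by (apply Rmult_le_pos; auto). lra.
Qed.

(** Used with [c = sqrt A * s] to bound the arrival time at [1]. Without the added [s] the scheme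
    would never leave [-1], where [g] vanishes. *)
Lemma truncated_euler_speed h G c n :
  0 <= h -> 0 <= c -> (forall x, c <= G x) ->
  Rmin 1 (-1 + INR n * h * c) <= truncated_euler h G n.
Proof.
  intros Hh Hc HG. induction n.
  - simpl. apply Rle_trans with (1 := Rmin_r _ _). lra.
  - rewrite S_INR. cbn [truncated_euler].
    assert (0 <= h * c) by (apply Rmult_le_pos; assumption).
    assert (h * c <= h * G (truncated_euler h G n)) by (apply Rmult_le_compat_l; auto).
    apply Rmin_glb; [apply Rmin_l|].
    unfold Rmin in IHn. destruct (Rle_dec 1 (-1 + INR n * h * c)).
    + apply Rle_trans with (1 := Rmin_l _ _). lra.
    + apply Rle_trans with (1 := Rmin_r _ _). lra.
Qed.

(** The competitor waits at [-1] up to index [k], runs the Euler scheme, and rests at [1]. Waiting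
    and resting are free, so [b i <= A] is needed only during a time [L], which depends on neither
    the grid nor [b]. *)
Lemma action_upper_bound (V W : R -> R) s A :
  (forall x, ex_derive V x) -> (forall x, continuous (Derive V) x) ->
  (forall x, 0 <= V x) -> V (-1) = 0 -> V 1 = 0 ->
  (forall x, is_derive W x (sqrt (2 * V x))) -> 0 < s -> 0 < A ->
  exists C L, 0 <= C /\ 0 <= L /\ forall h b k N,
    0 < h -> (forall i, 0 <= b i) ->
    (forall i, (k <= i)%nat -> INR (i - k) * h <= L -> b i <= A) ->
    (k <= N)%nat -> L <= INR (N - k) * h ->
    exists y, admissible N y /\
      action h b V y N <= sqrt A * (W 1 - W (-1) + 2 * s) + C * h.
Proof.
  intros Hd Hc HV HV1 HV2 HW Hs HA.
  destruct (smooth_calibration V s Hd Hc HV Hs) as [g [Gam [K [HK [Hg [HgK [HG HT]]]]]]].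
  assert (Hr := sqrt_lt_R0 A HA). assert (Hr2 := pow2_sqrt A ltac:(lra)).
  set (r := sqrt A) in *.
  set (B := K + s).
  (* The first summand is the Taylor error accumulated over the distance [2], the second the
     potential cost of the one step cut off at [1]. The time is the distance [2] over the least
     speed [r * s]. *)
  exists (2 * r * (K * r * B) + r ^ 2 * B ^ 2 / 2), (2 / (r * s)).
  assert (HKB : 0 <= K * r * B) by (unfold B; repeat apply Rmult_le_pos; lra).
  split; [pose proof (pow2_ge_0 r); pose proof (pow2_ge_0 B); nra|].
  assert (Hrs : 0 < r * s) by now apply Rmult_lt_0_compat.
  split; [apply Rdiv_le_0_compat; lra|].
  intros h b k N Hh Hb HbA HkN HL.
  set (e := truncated_euler h (fun x => r * (g x + s))).
  assert (HGp : forall x, r * s <= r * (g x + s)).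
  { intros x. apply Rmult_le_compat_l; [lra|]. destruct (Hg x). lra. }
  assert (He : forall n, -1 <= e n <= 1).
  { intros n. apply truncated_euler_bounds; [lra|]. intros x. specialize (HGp x). lra. }
  assert (Hsp : forall n, Rmin 1 (-1 + INR n * h * (r * s)) <= e n).
  { intros n. apply truncated_euler_speed; [lra|lra|apply HGp]. }
  (* Truncated subtraction makes [y] equal to [-1] for all [i <= k]. *)
  set (y := fun i => e (i - k)%nat).
  (* The first two terms form a primitive of [g + s]. The third absorbs the Taylor remainder, since
     [D <= h * r * B] gives [K * D ^ 2 <= K * h * r * B * D]. *)
  set (Phi := fun z => Gam z + s * z + K * h * r * B * z).
  assert (Hinv : forall n, action h b V y (k + n)%nat <= r * (Phi (e n) - Phi (-1))
      + (if Rlt_dec (e n) 1 then 0 else h * (r ^ 2 * B ^ 2 / 2))).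
  { induction n as [|n IH].
    - assert (H0 : forall m, (m <= k)%nat -> action h b V y m = 0).
      { induction m as [|m IHm]; intros Hm; [reflexivity|].
        cbn [action]. rewrite IHm by lia.
        unfold y. replace (S m - k)%nat with 0%nat by lia. replace (m - k)%nat with 0%nat by lia.
        change (e 0%nat) with (-1). rewrite HV1. field. lra. }
      rewrite Nat.add_0_r, H0 by lia. change (e 0%nat) with (-1).
      destruct (Rlt_dec (-1) 1); lra.
    - rewrite Nat.add_succ_r. cbn [action].
      replace (y (S (k + n))) with (e (S n)) by (unfold y; f_equal; lia).
      replace (y (k + n)%nat) with (e n) by (unfold y; f_equal; lia).
      destruct (Rlt_dec (e n) 1) as [Hlt|Hge].
      + assert (HbV : h * b (k + n)%nat * V (e n) <= h * (r ^ 2 * ((g (e n) + s) ^ 2 / 2))).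
        { rewrite Rmult_assoc. apply Rmult_le_compat_l; [lra|].
          apply Rmult_le_compat; [apply Hb|apply HV| |].
          - rewrite Hr2. apply HbA; [lia|].
            replace (k + n - k)%nat with n by lia.
            specialize (Hsp n). unfold Rmin in Hsp.
            destruct (Rle_dec 1 (-1 + INR n * h * (r * s))); [lra|].
            apply (Rle_div_r _ _ _ Hrs). lra.
          - destruct (Hg (e n)) as [_ [_ H]]. lra. }
        assert (HGB : 0 <= g (e n) + s <= B).
        { unfold B. specialize (HgK (e n) (He n)). destruct (Hg (e n)). lra. }
        specialize (HT (e n) (e (S n)) (He n) (He (S n))).
        apply Rabs_le_between in HT.
        assert (HeS : e (S n) = Rmin 1 (e n + h * (r * (g (e n) + s)))) by reflexivity.
        set (D := e (S n) - e n) in *. set (G := g (e n) + s) in *.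
        assert (HD : 0 <= D <= h * (r * G)).
        { unfold D. rewrite HeS. split.
          - assert (0 <= h * (r * G)) by (repeat apply Rmult_le_pos; lra).
            assert (Hm : e n <= Rmin 1 (e n + h * (r * G)))
              by (apply Rmin_glb; [apply He|lra]).
            lra.
          - assert (Hm := Rmin_r 1 (e n + h * (r * G))). lra. }
        (* Kinetic energy takes at most half of [r * (D * G)]; in a step that is not cut off the
           potential energy takes at most the other half. In the step cut off at [1] the potential
           part may be larger, which the extra summand of [Hinv] covers once. *)
        assert (HD2 : D ^ 2 / (2 * h) <= r * (D * G) / 2).
        { apply Rle_div_l; [apply Rlt_gt; lra|].
          replace (r * (D * G) / 2 * (2 * h)) with (D * (h * (r * G))) by field.
          replace (D ^ 2) with (D * D) by ring. apply Rmult_le_compat_l; lra. }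
        assert (HPhi : r * (D * G) <= r * (Phi (e (S n)) - Phi (e n))).
        { apply Rmult_le_compat_l; [lra|]. unfold Phi.
          assert (K * D ^ 2 <= K * h * r * B * D).
          { assert (D ^ 2 <= h * (r * B) * D).
            { replace (D ^ 2) with (D * D) by ring. apply Rmult_le_compat_r; [lra|].
              apply Rle_trans with (1 := proj2 HD).
              apply Rmult_le_compat_l; [lra|]. apply Rmult_le_compat_l; lra. }
            replace (K * h * r * B * D) with (K * (h * (r * B) * D)) by ring.
            apply Rmult_le_compat_l; lra. }
          replace (D * G) with (g (e n) * D + s * D) by (unfold G; ring).
          assert (s * D = s * e (S n) - s * e n) by (unfold D; ring).
          assert (K * h * r * B * D = K * h * r * B * e (S n) - K * h * r * B * e n)
            by (unfold D; ring).
          lra. }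
        assert (HDG0 : 0 <= r * (D * G)) by (repeat apply Rmult_le_pos; lra).
        destruct (Rlt_dec (e (S n)) 1) as [Hlt'|Hge'].
        * assert (HDe : D = h * (r * G)).
          { unfold D. rewrite HeS in Hlt' |- *. unfold Rmin in *.
            destruct (Rle_dec 1 (e n + h * (r * G))); lra. }
          replace (h * (r ^ 2 * (G ^ 2 / 2))) with (r * (D * G) / 2) in HbV
            by (rewrite HDe; field).
          lra.
        * assert (h * (r ^ 2 * (G ^ 2 / 2)) <= h * (r ^ 2 * B ^ 2 / 2)).
          { apply Rmult_le_compat_l; [lra|].
            assert (r ^ 2 * G ^ 2 <= r ^ 2 * B ^ 2); [|lra].
            apply Rmult_le_compat_l; [apply pow2_ge_0|]. apply pow_incr. lra. }
          lra.
      + assert (He1 : e n = 1) by (generalize (He n); lra).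
        assert (HeS : e (S n) = 1).
        { change (e (S n)) with (Rmin 1 (e n + h * (r * (g (e n) + s)))).
          rewrite Rmin_left; [reflexivity|]. rewrite He1.
          assert (0 <= h * (r * (g 1 + s))).
          { apply Rmult_le_pos; [lra|]. specialize (HGp 1). lra. }
          lra. }
        rewrite HeS, He1 in *. rewrite HV2.
        destruct (Rlt_dec 1 1); [lra|].
        replace ((1 - 1) ^ 2 / (2 * h) + h * b (k + n)%nat * 0) with 0 by (field; lra). lra. }
  exists y. assert (HeN : e (N - k)%nat = 1).
  { apply Rle_antisym; [apply He|]. apply Rle_trans with (2 := Hsp _).
    apply Rmin_glb; [lra|]. apply (Rle_div_l _ _ _ Hrs) in HL. lra. }
  split.
  - split; [reflexivity|]. split; [exact HeN|]. intros i. apply He.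
  - specialize (Hinv (N - k)%nat). replace (k + (N - k))%nat with N in Hinv by lia.
    rewrite HeN in Hinv. destruct (Rlt_dec 1 1); [lra|].
    assert (HGW : Gam 1 - Gam (-1) <= W 1 - W (-1)).
    { apply increment_le with g (fun z => sqrt (2 * V z)); auto; [lra|].
      intros z _. destruct (Hg z) as [H1 [H2 _]].
      rewrite <- (sqrt_pow2 (g z)) by assumption. now apply sqrt_le_1_alt. }
    apply Rle_trans with (1 := Hinv). unfold Phi.
    assert (r * (Gam 1 - Gam (-1)) <= r * (W 1 - W (-1))) by (apply Rmult_le_compat_l; lra).
    lra.
Qed.

(** Each step begun in the middle region costs at least [h * (a0 * m)], and the budget [E] cannot
    pay for [n] of them in a row. *)
Lemma leaves_middle V h b x N E a0 rho m i n :
  (forall y, 0 <= V y) -> 0 < h -> 0 < a0 -> action h b V x N <= E ->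
  (forall j, a0 <= b j) -> (i + n <= N)%nat ->
  (forall y, -1 + rho <= y <= 1 - rho -> m <= V y) -> E < INR n * h * (a0 * m) ->
  exists j, (i <= j <= i + n)%nat /\ (x j <= -1 + rho \/ 1 - rho <= x j).
Proof.
  intros HV Hh Ha0 HE Hb HiN Hm HEn.
  assert (Hmono : forall p q, (p <= q)%nat -> action h b V x p <= action h b V x q).
  { intros p q Hpq. apply action_le; auto. intros j. specialize (Hb j). lra. }
  apply NNPP. intros Hn.
  assert (H : forall d, (d <= n)%nat ->
    INR d * h * (a0 * m) <= action h b V x (i + d) - action h b V x i).
  { induction d as [|d IH]; intros Hdn.
    - rewrite Nat.add_0_r. simpl. lra.
    - rewrite Nat.add_succ_r, S_INR. cbn [action]. specialize (IH ltac:(lia)).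
      assert (HmV : m <= V (x (i + d)%nat)).
      { apply Hm. split; apply Rnot_lt_le; intros Hlt; apply Hn;
          exists (i + d)%nat; (split; [lia|lra]). }
      assert (0 <= (x (S (i + d)) - x (i + d)%nat) ^ 2 / (2 * h)).
      { apply Rdiv_le_0_compat; [apply pow2_ge_0|lra]. }
      assert (h * (a0 * m) <= h * b (i + d)%nat * V (x (i + d)%nat)).
      { rewrite Rmult_assoc. apply Rmult_le_compat_l; [lra|].
        apply Rle_trans with (a0 * V (x (i + d)%nat)).
        - apply Rmult_le_compat_l; lra.
        - apply Rmult_le_compat_r; [apply HV|apply Hb]. }
      lra. }
  specialize (H n (le_n n)).
  assert (H0 := Hmono 0%nat i ltac:(lia)). simpl in H0.
  generalize (Hmono (i + n)%nat N HiN). lra.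
Qed.

(* Pure energy counting. If [x i] is already away from [-1] while [b >= a1] has held so far
   and still holds for the next [n] steps, then the path afterwards either comes back
   near [-1], having to start again, or reaches [1] while [b >= a1], or lingers
   where [V >= m]; all three cost more than [E]. *)
Lemma localization_left V W C s h b x N E a0 a1 rho rho' m i n :
  (forall y, 0 <= V y) ->
  (forall y z, y <= z -> W y <= W z) ->
  (forall beta p q, 0 <= beta -> (p <= q)%nat ->
    (forall j, (p <= j < q)%nat -> beta <= b j) ->
    sqrt beta * (W (x q) - W (x p) - 2 * s
                 - C * h * (action h b V x q - action h b V x p))
      <= action h b V x q - action h b V x p) ->
  0 < h -> 0 <= C -> 0 < a0 -> 0 <= a1 -> admissible N x -> action h b V x N <= E ->
  (forall j, a0 <= b j) -> (i + n <= N)%nat -> (forall j, (j < i + n)%nat -> a1 <= b j) ->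
  (forall y, -1 + rho <= y <= 1 - rho -> m <= V y) ->
  E < INR n * h * (a0 * m) ->
  E < sqrt a0 * (W (-1 + rho') + W 1 - W (-1 + rho) - W (-1) - 4 * s - C * h * E) ->
  E < sqrt a1 * (W (1 - rho) - W (-1) - 2 * s - C * h * E) ->
  x i < -1 + rho'.
Proof.
  intros HV HWm Hlow Hh HC Ha0 Ha1 [Hx0 [HxN Hx]] HE Hb HiN Hb1 Hm HEn HE1 HE2.
  apply Rnot_le_lt. intros Hi.
  assert (Hb0 : forall j, 0 <= b j) by (intros j; specialize (Hb j); lra).
  assert (Hmono : forall p q, (p <= q)%nat -> action h b V x p <= action h b V x q).
  { intros p q Hpq. now apply action_le. }
  assert (Hnn := Hmono 0%nat). simpl in Hnn.
  assert (HCh : 0 <= C * h) by (apply Rmult_le_pos; lra).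
  assert (Hex := leaves_middle V h b x N E a0 rho m i n HV Hh Ha0 HE Hb HiN Hm HEn).
  destruct Hex as [j [Hj Hxj]].
  assert (HjN : action h b V x j <= action h b V x N) by (apply Hmono; lia).
  destruct Hxj as [Hxj|Hxj].
  - assert (H1 := Hlow a0 0%nat i ltac:(lra) ltac:(lia) ltac:(intros; apply Hb)).
    assert (H2 := Hlow a0 j N ltac:(lra) ltac:(lia) ltac:(intros; apply Hb)).
    rewrite Hx0 in H1. rewrite HxN in H2. simpl in H1.
    assert (Hij := Hmono i j ltac:(lia)).
    assert (HW1 := HWm _ _ Hi). assert (HW2 := HWm _ _ Hxj).
    assert (Hchain : sqrt a0 * (W (-1 + rho') + W 1 - W (-1 + rho) - W (-1) - 4 * s - C * h * E)
      <= sqrt a0 * ((W (x i) - W (-1) - 2 * s - C * h * (action h b V x i - 0))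
          + (W 1 - W (x j) - 2 * s - C * h * (action h b V x N - action h b V x j)))).
    { apply Rmult_le_compat_l; [apply sqrt_pos|].
      assert (C * h * (action h b V x i + (action h b V x N - action h b V x j)) <= C * h * E).
      { apply Rmult_le_compat_l; lra. }
      lra. }
    lra.
  - assert (H1 := Hlow a1 0%nat j ltac:(lra) ltac:(lia) ltac:(intros; apply Hb1; lia)).
    rewrite Hx0 in H1. simpl in H1. assert (HW1 := HWm _ _ Hxj).
    assert (sqrt a1 * (W (1 - rho) - W (-1) - 2 * s - C * h * E)
      <= sqrt a1 * (W (x j) - W (-1) - 2 * s - C * h * (action h b V x j - 0))).
    { apply Rmult_le_compat_l; [apply sqrt_pos|].
      assert (C * h * (action h b V x j) <= C * h * E).
      { apply Rmult_le_compat_l; lra. }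
      lra. }
    lra.
Qed.

(** Within the [n] steps after [i] the path visits a well. From near [-1] the whole transition would
    still have to be paid at the rate of [a1]; from near [1], being away from [1] at [i + n] forces
    a second climb. The argument is repeated instead of reflected because sampling [V] at left ends
    breaks the symmetry of the action under time reversal. *)
Lemma localization_right V W C s h b x N E a0 a1 rho rho' m i n :
  (forall y, 0 <= V y) ->
  (forall y z, y <= z -> W y <= W z) ->
  (forall beta p q, 0 <= beta -> (p <= q)%nat ->
    (forall j, (p <= j < q)%nat -> beta <= b j) ->
    sqrt beta * (W (x q) - W (x p) - 2 * s
                 - C * h * (action h b V x q - action h b V x p))
      <= action h b V x q - action h b V x p) ->
  0 < h -> 0 <= C -> 0 < a0 -> 0 <= a1 -> admissible N x -> action h b V x N <= E ->
  (forall j, a0 <= b j) -> (i + n <= N)%nat -> (forall j, (i <= j)%nat -> a1 <= b j) ->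
  (forall y, -1 + rho <= y <= 1 - rho -> m <= V y) ->
  E < INR n * h * (a0 * m) ->
  E < sqrt a0 * (W (1 - rho) + W 1 - W (1 - rho') - W (-1) - 4 * s - C * h * E) ->
  E < sqrt a1 * (W 1 - W (-1 + rho) - 2 * s - C * h * E) ->
  1 - rho' < x (i + n)%nat.
Proof.
  intros HV HWm Hlow Hh HC Ha0 Ha1 [Hx0 [HxN Hx]] HE Hb HiN Hb1 Hm HEn HE1 HE2.
  apply Rnot_le_lt. intros Hi.
  assert (Hb0 : forall j, 0 <= b j) by (intros j; specialize (Hb j); lra).
  assert (Hmono : forall p q, (p <= q)%nat -> action h b V x p <= action h b V x q).
  { intros p q Hpq. now apply action_le. }
  assert (Hnn := Hmono 0%nat). simpl in Hnn.
  assert (HCh : 0 <= C * h) by (apply Rmult_le_pos; lra).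
  assert (Hex := leaves_middle V h b x N E a0 rho m i n HV Hh Ha0 HE Hb HiN Hm HEn).
  destruct Hex as [j [Hj Hxj]].
  assert (Hj0 := Hnn j ltac:(lia)).
  destruct Hxj as [Hxj|Hxj].
  - assert (H1 := Hlow a1 j N ltac:(lra) ltac:(lia) ltac:(intros; apply Hb1; lia)).
    rewrite HxN in H1. assert (HW1 := HWm _ _ Hxj).
    assert (sqrt a1 * (W 1 - W (-1 + rho) - 2 * s - C * h * E)
      <= sqrt a1 * (W 1 - W (x j) - 2 * s
           - C * h * (action h b V x N - action h b V x j))).
    { apply Rmult_le_compat_l; [apply sqrt_pos|].
      assert (C * h * (action h b V x N - action h b V x j) <= C * h * E).
      { apply Rmult_le_compat_l; lra. }
      lra. }
    lra.
  - assert (H1 := Hlow a0 0%nat j ltac:(lra) ltac:(lia) ltac:(intros; apply Hb)).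
    assert (H2 := Hlow a0 (i + n)%nat N ltac:(lra) ltac:(lia) ltac:(intros; apply Hb)).
    rewrite Hx0 in H1. rewrite HxN in H2. simpl in H1.
    assert (Hij := Hmono j (i + n)%nat ltac:(lia)).
    assert (HW1 := HWm _ _ Hi). assert (HW2 := HWm _ _ Hxj).
    assert (Hchain : sqrt a0 * (W (1 - rho) + W 1 - W (1 - rho') - W (-1) - 4 * s - C * h * E)
      <= sqrt a0 * ((W (x j) - W (-1) - 2 * s - C * h * (action h b V x j - 0))
          + (W 1 - W (x (i + n)%nat) - 2 * s
             - C * h * (action h b V x N - action h b V x (i + n)%nat)))).
    { apply Rmult_le_compat_l; [apply sqrt_pos|].
      assert (C * h * (action h b V x j
          + (action h b V x N - action h b V x (i + n)%nat)) <= C * h * E).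
      { apply Rmult_le_compat_l; lra. }
      lra. }
    lra.
Qed.

(** * Discrete Taylor estimates *)

Definition velocity (h : R) (x : nat -> R) (i : nat) : R := (x (S i) - x i) / h.

(** The second differences telescope to a Riemann sum of [f]. The choice [q = 0] gives the Lipschitz
    bound for velocities; taking for [q] the value of the right-hand side at a point gives their
    derivative in the limit. *)
Lemma velocity_increment h x f N q eta i j :
  0 < h -> (forall l, (S l < N)%nat ->
    x (S (S l)) - 2 * x (S l) + x l = h ^ 2 * f (S l)) ->
  (forall l, (i < l <= j)%nat -> Rabs (f l - q) <= eta) ->
  (i <= j)%nat -> (j < N)%nat ->
  Rabs (velocity h x j - velocity h x i - INR (j - i) * h * q) <= INR (j - i) * h * eta.
Proof.
  intros Hh Hf Hq Hij. induction Hij as [|j Hij IH]; intros HjN.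
  - rewrite Nat.sub_diag. simpl.
    replace (velocity h x i - velocity h x i - 0 * h * q) with 0 by ring.
    rewrite Rabs_R0. lra.
  - specialize (IH ltac:(intros; apply Hq; lia) ltac:(lia)).
    replace (S j - i)%nat with (S (j - i)) by lia. rewrite S_INR.
    assert (Hstep : velocity h x (S j) = velocity h x j + h * f (S j)).
    { unfold velocity. specialize (Hf j HjN).
      replace (x (S (S j)) - x (S j)) with (x (S j) - x j + h ^ 2 * f (S j)) by lra.
      field. lra. }
    rewrite Hstep.
    specialize (Hq (S j) ltac:(lia)).
    replace (velocity h x j + h * f (S j) - velocity h x i - (INR (j - i) + 1) * h * q)
      with ((velocity h x j - velocity h x i - INR (j - i) * h * q) + h * (f (S j) - q)) by ring.
    apply Rle_trans with (1 := Rabs_triang _ _).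
    rewrite (Rabs_mult h), (Rabs_pos_eq h) by lra.
    assert (h * Rabs (f (S j) - q) <= h * eta) by (apply Rmult_le_compat_l; lra). lra.
Qed.

Lemma discrete_taylor h x D i j :
  0 < h -> 0 <= D -> (i <= j)%nat ->
  (forall l, (i <= l < j)%nat ->
     Rabs (velocity h x l - velocity h x i) <= INR (l - i) * h * D) ->
  Rabs (x j - x i - INR (j - i) * h * velocity h x i) <= (INR (j - i) * h) ^ 2 * D.
Proof.
  intros Hh HD Hij. induction Hij as [|j Hij IH]; intros Hv.
  - rewrite Nat.sub_diag. simpl.
    replace (x i - x i - 0 * h * velocity h x i) with 0 by ring. rewrite Rabs_R0. lra.
  - specialize (IH ltac:(intros; apply Hv; lia)). specialize (Hv j ltac:(lia)).
    replace (S j - i)%nat with (S (j - i)) by lia. rewrite S_INR.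
    assert (0 <= INR (j - i)) by apply pos_INR.
    replace (x (S j)) with (x j + h * velocity h x j) by (unfold velocity; field; lra).
    replace (x j + h * velocity h x j - x i - (INR (j - i) + 1) * h * velocity h x i)
      with ((x j - x i - INR (j - i) * h * velocity h x i)
            + h * (velocity h x j - velocity h x i)) by ring.
    apply Rle_trans with (1 := Rabs_triang _ _).
    rewrite (Rabs_mult h), (Rabs_pos_eq h) by lra.
    assert (h * Rabs (velocity h x j - velocity h x i) <= h * (INR (j - i) * h * D))
      by (apply Rmult_le_compat_l; lra).
    assert (0 <= h * h * D) by (repeat apply Rmult_le_pos; lra).
    assert (0 <= INR (j - i) * (h * h * D)) by (apply Rmult_le_pos; lra).
    replace (((INR (j - i) + 1) * h) ^ 2 * D) with
      ((INR (j - i) * h) ^ 2 * D + 2 * (INR (j - i) * (h * h * D)) + h * h * D) by ring.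
    replace (h * (INR (j - i) * h * D)) with (INR (j - i) * (h * h * D)) in H0 by ring.
    lra.
Qed.

Lemma discrete_lipschitz h x B i j :
  0 < h -> (i <= j)%nat -> (forall l, (i <= l < j)%nat -> Rabs (velocity h x l) <= B) ->
  Rabs (x j - x i) <= INR (j - i) * h * B.
Proof.
  intros Hh Hij. induction Hij as [|j Hij IH]; intros Hv.
  - rewrite Nat.sub_diag. simpl. rewrite Rminus_diag, Rabs_R0. lra.
  - specialize (IH ltac:(intros; apply Hv; lia)). specialize (Hv j ltac:(lia)).
    replace (S j - i)%nat with (S (j - i)) by lia. rewrite S_INR.
    replace (x (S j) - x i) with ((x j - x i) + h * velocity h x j)
      by (unfold velocity; field; lra).
    apply Rle_trans with (1 := Rabs_triang _ _).
    rewrite (Rabs_mult h), (Rabs_pos_eq h) by lra.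
    assert (h * Rabs (velocity h x j) <= h * B) by (apply Rmult_le_compat_l; lra). lra.
Qed.

(* Step [1/(n+1)] on the time interval [[-(n+1), n+1]]: both refine and exhaust the line. *)
Definition grid_step (n : nat) : R := / INR (S n).
Definition grid_half (n : nat) : nat := (S n * S n)%nat.
Definition grid_time (n i : nat) : R := (INR i - INR (grid_half n)) * grid_step n.
(* [Z.to_nat] clips to the index [0] when [t < -(n+1)]. *)
Definition grid_index (n : nat) (t : R) : nat :=
  Z.to_nat (Int_part (t * INR (S n)) + Z.of_nat (grid_half n)).

Lemma grid_step_pos n : 0 < grid_step n.
Proof. apply Rinv_0_lt_compat, lt_0_INR. lia. Qed.

Lemma grid_time_diff n i j : (i <= j)%nat ->
  INR (j - i) * grid_step n = grid_time n j - grid_time n i.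
Proof. intros Hij. unfold grid_time. rewrite minus_INR by assumption. ring. Qed.

Lemma grid_time_le n i j : grid_time n i <= grid_time n j -> (i <= j)%nat.
Proof.
  intros H. apply INR_le. unfold grid_time in H.
  apply Rmult_le_reg_r in H; [lra|apply grid_step_pos].
Qed.

Lemma grid_index_time n t : - INR (S n) <= t ->
  t - grid_step n < grid_time n (grid_index n t) <= t.
Proof.
  intros Ht. unfold grid_time, grid_index.
  assert (Hn : 0 < INR (S n)) by (apply lt_0_INR; lia).
  destruct (base_Int_part (t * INR (S n))) as [H1 H2].
  assert (Hk : INR (grid_half n) = INR (S n) * INR (S n)) by apply mult_INR.
  assert (Hge : (0 <= Int_part (t * INR (S n)) + Z.of_nat (grid_half n))%Z).
  { assert (-1 < Int_part (t * INR (S n)) + Z.of_nat (grid_half n))%Z; [|lia].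
    apply lt_IZR. rewrite plus_IZR, <- INR_IZR_INZ, Hk. nra. }
  rewrite INR_IZR_INZ, Z2Nat.id by assumption. rewrite plus_IZR, <- INR_IZR_INZ.
  replace (IZR (Int_part (t * INR (S n))) + INR (grid_half n) - INR (grid_half n))
    with (IZR (Int_part (t * INR (S n)))) by ring.
  unfold grid_step. replace (t - / INR (S n)) with ((t * INR (S n) - 1) * / INR (S n))
    by (field; lra).
  assert (Hi := Rinv_0_lt_compat _ Hn). split.
  - apply Rmult_lt_compat_r; lra.
  - replace t with (t * INR (S n) * / INR (S n)) at 2 by (field; lra).
    apply Rmult_le_compat_r; lra.
Qed.

Lemma grid_index_mono n s t :
  - INR (S n) <= s -> s <= t -> (grid_index n s <= grid_index n t)%nat.
Proof.
  intros Hs Hst. apply Nat.lt_succ_r. apply INR_lt.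
  destruct (grid_index_time n s Hs) as [_ H1].
  destruct (grid_index_time n t ltac:(lra)) as [H2 _].
  rewrite S_INR. unfold grid_time in *.
  apply (Rmult_lt_reg_r (grid_step n)); [apply grid_step_pos|]. lra.
Qed.

(** Of the two time units kept free at the right end, the velocity bound looks ahead over one. *)
Lemma grid_room n i : grid_time n i <= INR (S n) - 2 ->
  (i + 2 * S n <= 2 * grid_half n)%nat.
Proof.
  intros H. apply INR_le. rewrite plus_INR, !mult_INR. change (INR 2) with 2.
  unfold grid_time, grid_step in H.
  assert (Hn : 0 < INR (S n)) by (apply lt_0_INR; lia).
  assert (Hk : INR (grid_half n) = INR (S n) * INR (S n)) by apply mult_INR.
  apply (Rmult_le_compat_r (INR (S n))) in H; [|lra].
  rewrite Rmult_assoc, Rinv_l in H by lra. rewrite Hk in *. lra.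
Qed.

Section GridEstimates.
Context (n : nat) (x f : nat -> R) (D : R) (HD : 0 <= D)
  (Hx : forall i, -1 <= x i <= 1)
  (Hf : forall i, (S i < 2 * grid_half n)%nat ->
     x (S (S i)) - 2 * x (S i) + x i = grid_step n ^ 2 * f (S i))
  (HfD : forall i, Rabs (f i) <= D).

Lemma grid_velocity_lipschitz i j : (i <= j)%nat -> (j < 2 * grid_half n)%nat ->
  Rabs (velocity (grid_step n) x j - velocity (grid_step n) x i)
    <= INR (j - i) * grid_step n * D.
Proof.
  intros Hij Hj.
  assert (H := velocity_increment _ x f _ 0 D i j (grid_step_pos n) Hf).
  rewrite Rmult_0_r, Rminus_0_r in H. apply H; auto.
  intros l _. rewrite Rminus_0_r. apply HfD.
Qed.

(** Over one unit of time, that is [S n] steps, the values move by at most [2] and the Taylor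
    remainder is at most [D]. This bound is uniform in the grid and uses no energy. *)
Lemma grid_velocity_bound i : (i + S n <= 2 * grid_half n)%nat ->
  Rabs (velocity (grid_step n) x i) <= 2 + D.
Proof.
  intros Hi.
  assert (H := discrete_taylor (grid_step n) x D i (i + S n) (grid_step_pos n) HD ltac:(lia)).
  replace (i + S n - i)%nat with (S n) in H by lia.
  replace (INR (S n) * grid_step n) with 1 in H
    by (unfold grid_step; rewrite Rinv_r; [reflexivity|apply not_0_INR; lia]).
  specialize (H ltac:(intros; apply grid_velocity_lipschitz; lia)).
  apply Rabs_le_between in H. apply Rabs_le_between.
  pose proof (Hx i). pose proof (Hx (i + S n)). lra.
Qed.

Lemma grid_lipschitz i j : (i <= j)%nat -> (j + S n <= 2 * grid_half n)%nat ->
  Rabs (x j - x i) <= INR (j - i) * grid_step n * (2 + D).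
Proof.
  intros Hij Hj. apply discrete_lipschitz; auto using grid_step_pos.
  intros l Hl. apply grid_velocity_bound. lia.
Qed.

Context (s t : R) (Hs : - INR (S n) <= s) (Hst : s <= t) (Ht : t <= INR (S n) - 2).

Lemma grid_index_facts :
  (grid_index n s <= grid_index n t)%nat /\
  (grid_index n t + 2 * S n <= 2 * grid_half n)%nat /\
  t - s - grid_step n <= INR (grid_index n t - grid_index n s) * grid_step n
    <= t - s + grid_step n.
Proof.
  assert (Hi := grid_index_time n s Hs). assert (Hj := grid_index_time n t ltac:(lra)).
  assert (Hij := grid_index_mono n s t Hs Hst).
  split; [assumption|]. split; [apply grid_room; lra|].
  rewrite grid_time_diff by assumption. lra.
Qed.

(** The time between the two sampled grid points differs from [t - s] by at most one step; by the
    velocity bound this rounding costs [grid_step n * (2 + D)]. *)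
Lemma sampled_taylor :
  Rabs (x (grid_index n t) - x (grid_index n s)
        - (t - s) * velocity (grid_step n) x (grid_index n s))
    <= (t - s + grid_step n) ^ 2 * D + grid_step n * (2 + D).
Proof.
  destruct grid_index_facts as [Hij [Hj Hd]]. assert (Hh := grid_step_pos n).
  set (i := grid_index n s) in *. set (j := grid_index n t) in *.
  assert (HT := discrete_taylor (grid_step n) x D i j Hh HD Hij
    ltac:(intros; apply grid_velocity_lipschitz; lia)).
  assert (Hv := grid_velocity_bound i ltac:(lia)).
  set (v := velocity (grid_step n) x i) in *. set (d := INR (j - i) * grid_step n) in *.
  assert (H0 : 0 <= d) by (apply Rmult_le_pos; [apply pos_INR|lra]).
  replace (x j - x i - (t - s) * v) with ((x j - x i - d * v) + (d - (t - s)) * v) by ring.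
  apply Rle_trans with (1 := Rabs_triang _ _). apply Rplus_le_compat.
  - apply Rle_trans with (1 := HT). apply Rmult_le_compat_r; [assumption|].
    apply pow_incr. lra.
  - rewrite Rabs_mult. apply Rmult_le_compat; try apply Rabs_pos; [|assumption].
    apply Rabs_le_between. lra.
Qed.

Lemma sampled_velocity_increment q eta :
  0 <= eta ->
  (forall l, s - grid_step n < grid_time n l <= t -> Rabs (f l - q) <= eta) ->
  Rabs (velocity (grid_step n) x (grid_index n t) - velocity (grid_step n) x (grid_index n s)
        - (t - s) * q)
    <= (t - s + grid_step n) * eta + grid_step n * Rabs q.
Proof.
  intros Heta Hq.
  destruct grid_index_facts as [Hij [Hj Hd]]. assert (Hh := grid_step_pos n).
  assert (Hi' := grid_index_time n s Hs). assert (Hj' := grid_index_time n t ltac:(lra)).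
  set (i := grid_index n s) in *. set (j := grid_index n t) in *.
  assert (HT := velocity_increment (grid_step n) x f _ q eta i j Hh Hf).
  specialize (HT ltac:(intros l Hl; apply Hq;
    assert (H1 := grid_time_diff n i l ltac:(lia)); assert (H2 := grid_time_diff n l j ltac:(lia));
    assert (H3 := Rmult_le_pos _ _ (pos_INR (l - i)) (Rlt_le _ _ Hh));
    assert (H4 := Rmult_le_pos _ _ (pos_INR (j - l)) (Rlt_le _ _ Hh)); lra)
    Hij ltac:(lia)).
  set (vi := velocity (grid_step n) x i) in *. set (vj := velocity (grid_step n) x j) in *.
  set (d := INR (j - i) * grid_step n) in *.
  replace (vj - vi - (t - s) * q) with ((vj - vi - d * q) + (d - (t - s)) * q) by ring.
  apply Rle_trans with (1 := Rabs_triang _ _). apply Rplus_le_compat.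
  - apply Rle_trans with (1 := HT). apply Rmult_le_compat_r; lra.
  - rewrite Rabs_mult. apply Rmult_le_compat_r; [apply Rabs_pos|].
    apply Rabs_le_between. lra.
Qed.

End GridEstimates.

Lemma is_derive_of_increment f t l :
  (forall eta, 0 < eta -> exists d, 0 < d /\ forall y, Rabs (y - t) < d ->
     Rabs (f y - f t - (y - t) * l) <= eta * Rabs (y - t)) ->
  is_derive f t l.
Proof.
  intros H. apply is_derive_Reals. intros eps Heps.
  destruct (H (eps / 2) ltac:(lra)) as [d [Hd Hf]].
  exists (mkposreal d Hd). intros k Hk Hkd. simpl in Hkd.
  specialize (Hf (t + k)). replace (t + k - t) with k in Hf by ring.
  specialize (Hf Hkd).
  replace ((f (t + k) - f t) / k - l) with ((f (t + k) - f t - k * l) / k) by (field; auto).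
  assert (0 < Rabs k) by now apply Rabs_pos_lt.
  rewrite Rabs_div by assumption. apply Rlt_div_l; [assumption|]. nra.
Qed.

Lemma eventually_grid n0 M e : 0 < e ->
  eventually (fun n => (n0 <= n)%nat /\ M + 2 <= INR (S n) /\ grid_step n < e).
Proof.
  intros He.
  destruct (nfloor_ex (Rmax (Rabs M + 2) (/ e))) as [m [_ Hm]].
  { apply Rle_trans with (2 := Rmax_l _ _). pose proof (Rabs_pos M). lra. }
  exists (n0 + m)%nat. intros n Hn.
  assert (HI : INR m + 1 <= INR (S n)).
  { rewrite <- S_INR. apply le_INR. lia. }
  assert (H1 := Rmax_l (Rabs M + 2) (/ e)). assert (H2 := Rmax_r (Rabs M + 2) (/ e)).
  pose proof (Rle_abs M). assert (0 < / e) by now apply Rinv_0_lt_compat.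
  split; [lia|]. split; [lra|].
  unfold grid_step. rewrite <- (Rinv_inv e). apply Rinv_lt_contravar; [|lra].
  apply Rmult_lt_0_compat; lra.
Qed.

Lemma ultralimit_linear F {FF : Filter F} (u v w : nat -> R) (lu lv lw c : R) :
  filterlim u F (locally lu) -> filterlim v F (locally lv) -> filterlim w F (locally lw) ->
  filterlim (fun n => u n - v n - c * w n) F (locally (lu - lv - c * lw)).
Proof.
  intros Hu Hv Hw.
  assert (Hminus : forall (p q : nat -> R) (lp lq : R), filterlim p F (locally lp) ->
    filterlim q F (locally lq) -> filterlim (fun n => p n - q n) F (locally (lp - lq))).
  { intros p q lp lq Hp Hq.
    apply (filterlim_comp_2 (G := locally lp) (H := locally (- lq))
          p (fun k => - q k) Rplus Hp); [|apply (filterlim_plus lp (- lq))].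
    apply (filterlim_comp _ _ _ q Ropp _ (locally lq)); [apply Hq|apply (filterlim_opp lq)]. }
  apply Hminus; [now apply Hminus|].
  apply (filterlim_comp _ _ _ w (fun z => c * z) _ (locally lw)); [assumption|].
  apply (filterlim_scal_r c lw).
Qed.

Lemma ultralimit_abs_le F {FF : ProperFilter F} (u : nat -> R) (l c : R) :
  filterlim u F (locally l) ->
  (forall e, 0 < e -> F (fun n => Rabs (u n) <= c + e)) -> Rabs l <= c.
Proof.
  intros H Hc. apply (ultralimit_le F (fun n => Rabs (u n))); [|assumption].
  apply (filterlim_comp _ _ _ u Rabs _ (locally l)); [assumption|apply continuous_Rabs].
Qed.

(** * Continuum limit *)

Lemma continuous_product_near (b U : R -> R) t z eta :
  continuous b t -> continuous U z -> 0 < eta ->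
  exists d, 0 < d /\ forall t' z', Rabs (t' - t) < d -> Rabs (z' - z) < d ->
    Rabs (b t' * U z' - b t * U z) < eta.
Proof.
  intros Hb HU Heta.
  assert (H : continuous (fun p : R * R => b (fst p) * U (snd p)) (t, z)).
  { apply (continuous_mult (fun p : R * R => b (fst p)) (fun p : R * R => U (snd p))).
    - apply (continuous_comp fst b); [apply continuous_fst|exact Hb].
    - apply (continuous_comp snd U); [apply continuous_snd|exact HU]. }
  destruct (proj1 (filterlim_locally _ _) H (mkposreal eta Heta)) as [d Hd].
  exists d. split; [apply cond_pos|]. intros t' z' Ht Hz.
  exact (Hd (t', z') (conj Ht Hz)).
Qed.

(* Pointwise limits along a nonprincipal ultrafilter replace Arzela-Ascoli:
   the discrete Taylor estimates are uniform in [n] and pass to the limit. *)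
Lemma continuum_limit (b U : R -> R) D n0 (X : nat -> nat -> R) :
  (forall t, continuous b t) -> (forall z, continuous U z) -> 0 <= D ->
  (forall t z, -1 <= z <= 1 -> Rabs (b t * U z) <= D) ->
  (forall n i, (n0 <= n)%nat -> -1 <= X n i <= 1) ->
  (forall n i, (n0 <= n)%nat -> (S i < 2 * grid_half n)%nat ->
     X n (S (S i)) - 2 * X n (S i) + X n i
       = grid_step n ^ 2 * (b (grid_time n (S i)) * U (X n (S i)))) ->
  exists x v : R -> R,
    (forall t, is_derive x t (v t)) /\
    (forall t, is_derive v t (b t * U (x t))) /\
    (forall t lo hi, eventually (fun n => lo <= X n (grid_index n t) <= hi) ->
       lo <= x t <= hi).
Proof.
  intros Hb HU HD HbU HX HE.
  destruct ultrafilter_nat_exists as [F HF].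
  set (f := fun n i => b (grid_time n i) * U (X n i)).
  assert (HfD : forall n, (n0 <= n)%nat -> forall i, Rabs (f n i) <= D).
  { intros n Hn i. now apply HbU, HX. }
  set (vn := fun n t => velocity (grid_step n) (X n) (grid_index n t)).
  set (xn := fun n t => X n (grid_index n t)).
  assert (Hvb : forall n t, (n0 <= n)%nat -> Rabs t + 2 <= INR (S n) -> Rabs (vn n t) <= 2 + D).
  { intros n t Hn Ht. apply grid_velocity_bound with (f n);
      [assumption|intros; now apply HX|intros; now apply HE|now apply HfD|].
    assert (grid_index n t + 2 * S n <= 2 * grid_half n)%nat; [|lia].
    pose proof (Rle_abs t). pose proof (Rle_abs (- t)). rewrite Rabs_Ropp in *.
    apply grid_room. destruct (grid_index_time n t); lra. }
  assert (Hx : forall t, exists z, @filterlim nat R (fun n => xn n t) F (locally z)).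
  { intros t. apply ultralimit_exists with 1; [assumption|].
    apply (proj2 (proj2 HF)). exists n0. intros n Hn. apply Rabs_le_between. now apply HX. }
  assert (Hv : forall t, exists z, @filterlim nat R (fun n => vn n t) F (locally z)).
  { intros t. apply ultralimit_exists with (2 + D); [assumption|].
    apply (proj2 (proj2 HF)). generalize (eventually_grid n0 (Rabs t) 1 Rlt_0_1).
    apply filter_imp. intros n [Hn [Ht _]]. now apply Hvb. }
  apply choice in Hx. destruct Hx as [x Hx]. apply choice in Hv. destruct Hv as [v Hv].
  destruct HF as [FF [_ He]].
  assert (Hgrid : forall M e, 0 < e ->
    F (fun n => (n0 <= n)%nat /\ M + 2 <= INR (S n) /\ grid_step n < e)).
  { intros M e He'. now apply He, eventually_grid. }
  assert (Hrange : forall s t (n : nat), Rmax (Rabs s) (Rabs t) + 2 <= INR (S n) ->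
    - INR (S n) <= s /\ t <= INR (S n) - 2).
  { intros s t n Hn. pose proof (Rmax_l (Rabs s) (Rabs t)). pose proof (Rmax_r (Rabs s) (Rabs t)).
    pose proof (Rle_abs t). pose proof (Rle_abs (- s)). rewrite Rabs_Ropp in *. lra. }
  assert (Hpow : forall d n, 0 <= d -> grid_step n < 1 ->
    (d + grid_step n) ^ 2 <= d ^ 2 + grid_step n * (2 * d + 1)).
  { intros d n Hd Hn. pose proof (grid_step_pos n). nra. }
  assert (HxT : forall s t, s <= t -> Rabs (x t - x s - (t - s) * v s) <= D * (t - s) ^ 2).
  { intros s t Hst.
    apply (ultralimit_abs_le F (fun n => xn n t - xn n s - (t - s) * vn n s)).
    - apply ultralimit_linear; auto; apply FF.
    - intros e He'.
      (* Every error term carries a factor [grid_step n], and [c] collects the coefficients, so a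
         step below [e / c] keeps the total below [e]. *)
      set (c := D * (2 * (t - s) + 1) + (2 + D) + 1).
      assert (Hc : 0 < c).
      { assert (0 <= D * (2 * (t - s) + 1)) by (apply Rmult_le_pos; lra). unfold c; lra. }
      generalize (filter_and _ _ (Hgrid (Rmax (Rabs s) (Rabs t)) 1 Rlt_0_1)
        (Hgrid 0 (e / c) (Rdiv_lt_0_compat _ _ He' Hc))).
      apply filter_imp. intros n [[Hn [Hr H1]] [_ [_ H2]]].
      destruct (Hrange s t n Hr) as [Hs Ht].
      assert (HT := sampled_taylor n (X n) (f n) D HD (fun i => HX n i Hn)
        (fun i => HE n i Hn) (HfD n Hn) s t Hs Hst Ht).
      apply Rle_trans with (1 := HT).
      assert (H3 := Rmult_le_compat_r D _ _ HD (Hpow (t - s) n ltac:(lra) H1)).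
      assert (H4 := grid_step_pos n). apply (Rlt_div_r _ _ _ Hc) in H2.
      unfold c in H2. nra. }
  (* [M] lets the caller restrict the bound on [f] to grids that reach beyond a chosen time. *)
  assert (HvT : forall s t q eta M, s <= t -> 0 <= eta ->
    F (fun n => forall l, s - grid_step n < grid_time n l <= t ->
       (n0 <= n)%nat -> M + 2 <= INR (S n) -> Rabs (f n l - q) <= eta) ->
    Rabs (v t - v s - (t - s) * q) <= (t - s) * eta).
  { intros s t q eta M Hst Heta Hq.
    apply (ultralimit_abs_le F (fun n => vn n t - vn n s - (t - s) * q)).
    - apply (ultralimit_linear F (fun n => vn n t) (fun n => vn n s) (fun _ => q)); auto;
        try apply FF. apply filterlim_const.
    - intros e He'.
      set (c := eta + Rabs q + 1).
      assert (Hc : 0 < c) by (unfold c; pose proof (Rabs_pos q); lra).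
      generalize (filter_and _ _ Hq (filter_and _ _ (Hgrid M 1 Rlt_0_1)
       (filter_and _ _ (Hgrid (Rmax (Rabs s) (Rabs t)) 1 Rlt_0_1)
        (Hgrid 0 (e / c) (Rdiv_lt_0_compat _ _ He' Hc))))).
      apply filter_imp. intros n [H0 [[_ [HM _]] [[Hn [Hr H1]] [_ [_ H2]]]]].
      destruct (Hrange s t n Hr) as [Hs Ht].
      assert (HT := sampled_velocity_increment n (X n) (f n) (fun i => HE n i Hn)
        s t Hs Hst Ht q eta Heta
        (fun l Hl => H0 l Hl Hn HM)).
      apply Rle_trans with (1 := HT).
      assert (H4 := grid_step_pos n). apply (Rlt_div_r _ _ _ Hc) in H2.
      unfold c in H2. nra. }
  assert (HvL : forall s t, s <= t -> Rabs (v t - v s) <= (t - s) * D).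
  { intros s t Hst. generalize (HvT s t 0 D 0 Hst HD).
    rewrite Rmult_0_r, Rminus_0_r. intros H. apply H.
    apply He. exists 0%nat. intros n _ l _ Hn _. rewrite Rminus_0_r. now apply HfD. }
  exists x, v. split; [|split].
  - intros t. apply is_derive_of_increment. intros eta Heta.
    assert (HD2 : 0 < 2 * D + 1) by lra.
    exists (eta / (2 * D + 1)). split; [now apply Rdiv_lt_0_compat|].
    intros y Hy. apply (Rlt_div_r _ _ _ HD2) in Hy.
    assert (Hab := Rabs_pos (y - t)).
    (* [HxT] expands only from the earlier of two times. For [y < t], moving the base point from [y]
       to [t] costs a second [D * (t - y) ^ 2] by [HvL]. *)
    apply Rle_trans with (2 * D * Rabs (y - t) ^ 2); [|nra].
    destruct (Rle_lt_dec t y) as [Hty|Hty].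
    + rewrite (Rabs_pos_eq (y - t)) by lra. apply Rle_trans with (1 := HxT t y Hty).
      pose proof (pow2_ge_0 (y - t)). nra.
    + assert (H1 := HxT y t ltac:(lra)). assert (H2 := HvL y t ltac:(lra)).
      rewrite pow2_abs.
      replace (x y - x t - (y - t) * v t)
        with (- (x t - x y - (t - y) * v y) + (t - y) * (v t - v y)) by ring.
      apply Rle_trans with (1 := Rabs_triang _ _).
      rewrite Rabs_Ropp, Rabs_mult, (Rabs_pos_eq (t - y)) by lra.
      assert (H3 := Rmult_le_compat_l (t - y) _ _ ltac:(lra) H2).
      replace ((y - t) ^ 2) with ((t - y) ^ 2) by ring. nra.
  - intros t. apply is_derive_of_increment. intros eta Heta.
    destruct (continuous_product_near b U t (x t) eta (Hb t) (HU _) Heta) as [d1 [Hd1 Hnear]].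
    set (q := b t * U (x t)) in *.
    (* Convergence is known only at the single time [t]. The grid points concerned lie within
       [3 * d] of the one sampled at [t], so the Lipschitz constant [2 + D] moves the values by at
       most [3 * d1 / 8]; with [d1 / 2] from convergence the total stays below [d1]. *)
    set (d := d1 / (8 * (2 + D))).
    assert (Hd8 : d * (8 * (2 + D)) = d1) by (unfold d; field; lra).
    assert (Hd : 0 < d) by (unfold d; apply Rdiv_lt_0_compat; lra).
    exists d. split; [assumption|].
    assert (Hloc : forall s r, s <= r -> Rabs (s - t) <= d -> Rabs (r - t) <= d ->
      Rabs (v r - v s - (r - s) * q) <= (r - s) * eta).
    { intros s r Hsr Hs Hr. apply HvT with (M := Rabs t + 2 * d); [assumption|lra|].
      generalize (filter_and _ _ (Hgrid 0 d Hd)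
        (ultralimit_near F (fun n => xn n t) (x t) (d1 / 2) (Hx t) ltac:(lra))).
      apply filter_imp. intros n [[_ [_ Hh]] Hxn] l Hl Hn HM.
      apply Rabs_le_between in Hs. apply Rabs_le_between in Hr.
      assert (Hhp := grid_step_pos n).
      assert (HMt : - INR (S n) <= t /\ t <= INR (S n) - 2).
      { pose proof (Rle_abs t). pose proof (Rle_abs (- t)). rewrite Rabs_Ropp in *. lra. }
      assert (Htn := grid_index_time n t (proj1 HMt)).
      assert (HlX : Rabs (X n l - xn n t) <= 3 * d * (2 + D)).
      { unfold xn. set (i := grid_index n t) in *.
        assert (Hlip : forall p p', (p <= p')%nat -> grid_time n p' <= INR (S n) - 2 ->
          grid_time n p' - grid_time n p <= 3 * d ->
          Rabs (X n p' - X n p) <= 3 * d * (2 + D)).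
        { intros p p' Hpp Hp' Hgd. apply grid_room in Hp'.
          apply Rle_trans with (INR (p' - p) * grid_step n * (2 + D)).
          - apply grid_lipschitz with (f n); [assumption|intros; now apply HX|
              intros; now apply HE|now apply HfD|assumption|lia].
          - rewrite grid_time_diff by assumption. apply Rmult_le_compat_r; lra. }
        destruct (Nat.le_ge_cases i l) as [Hil|Hil].
        - apply Hlip; [assumption| |lra].
          pose proof (Rle_abs t). lra.
        - rewrite Rabs_minus_sym. apply Hlip; [assumption|lra|lra]. }
      left. apply Hnear.
      - apply Rabs_lt_between. assert (2 * d < d1) by nra. lra.
      - apply Rabs_le_between in HlX. apply Rabs_lt_between in Hxn.
        apply Rabs_lt_between. assert (3 * d * (2 + D) < d1 / 2) by nra. lra. }
    intros y Hy. destruct (Rle_lt_dec t y) as [Hty|Hty].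
    + rewrite (Rabs_pos_eq (y - t)) by lra. rewrite (Rmult_comm eta).
      apply Hloc; [assumption| |lra].
      rewrite Rminus_diag, Rabs_R0. lra.
    + replace (v y - v t - (y - t) * q) with (- (v t - v y - (t - y) * q)) by ring.
      rewrite Rabs_Ropp, (Rabs_minus_sym y t), (Rabs_pos_eq (t - y)) by lra.
      rewrite (Rmult_comm eta). apply Hloc; [lra|lra|]. rewrite Rminus_diag, Rabs_R0. lra.
  - intros t lo hi Hev. apply He in Hev. split.
    + assert (- x t <= - lo); [|lra].
      apply (ultralimit_le F (fun n => - xn n t)).
      * apply (filterlim_comp _ _ _ (fun n => xn n t) Ropp _ (locally (x t)));
          [apply Hx|apply (filterlim_opp (x t))].
      * intros e He'. revert Hev. apply filter_imp. intros n H. unfold xn. lra.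
    + apply (ultralimit_le F (fun n => xn n t)); [apply Hx|].
      intros e He'. revert Hev. apply filter_imp. intros n H. unfold xn. lra.
Qed.

(** * Second-order differential equations *)

(** [phi t * exp (- c * t)] is nonincreasing and [phi t * exp (c * t)] nondecreasing, so a zero
    spreads forwards by the first and backwards by the second. *)
Lemma gronwall_zero (phi dphi : R -> R) c t0 :
  (forall t, is_derive phi t (dphi t)) -> (forall t, 0 <= phi t) ->
  (forall t, Rabs (dphi t) <= c * phi t) -> phi t0 = 0 -> forall t, phi t = 0.
Proof.
  intros Hd Hpos Hb H0 t.
  assert (Hexp : forall k z, is_derive (fun s => phi s * exp (k * s)) z
    ((dphi z + k * phi z) * exp (k * z))).
  { intros k z. auto_derive; [eexists; apply Hd|].
    change (Derive (fun s => phi s) z) with (Derive phi z).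
    rewrite (is_derive_unique _ _ _ (Hd z)). ring. }
  assert (Hzero : forall z, is_derive (fun _ : R => 0) z 0) by (intros; apply @is_derive_const).
  assert (Hkey : forall k, phi t * exp (k * t) <= 0 -> phi t = 0).
  { intros k Hk. pose proof (exp_pos (k * t)). specialize (Hpos t). nra. }
  destruct (Rle_lt_dec t0 t) as [Ht|Ht].
  - apply (Hkey (- c)).
    generalize (increment_le _ _ _ _ t0 t (Hexp (- c)) Hzero Ht). rewrite H0. intros H.
    assert (phi t * exp (- c * t) - 0 * exp (- c * t0) <= 0 - 0); [|lra].
    apply H. intros z _. pose proof (exp_pos (- c * z)). specialize (Hb z).
    apply Rabs_le_between in Hb. nra.
  - apply (Hkey c).
    generalize (increment_le _ _ _ _ t t0 Hzero (Hexp c) (Rlt_le _ _ Ht)). rewrite H0. intros H.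
    assert (0 - 0 <= 0 * exp (c * t0) - phi t * exp (c * t)); [|lra].
    apply H. intros z _. pose proof (exp_pos (c * z)). specialize (Hb z).
    apply Rabs_le_between in Hb. nra.
Qed.

(** The squared distance to the equilibrium in the phase plane changes at a rate of at most [1 + c]
    times itself. Only a linear bound along the solution enters, which suits the time-dependent
    coefficient. *)
Lemma equilibrium_unique (x v q : R -> R) p c t0 :
  (forall t, is_derive x t (v t)) -> (forall t, is_derive v t (q t)) ->
  (forall t, Rabs (q t) <= c * Rabs (x t - p)) -> 0 <= c ->
  x t0 = p -> v t0 = 0 -> forall t, x t = p.
Proof.
  intros Hx Hv Hq Hc Hx0 Hv0 t.
  assert (H : (x t - p) ^ 2 + v t ^ 2 = 0).
  { apply (gronwall_zero (fun s => (x s - p) ^ 2 + v s ^ 2)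
      (fun s => 2 * (x s - p) * v s + 2 * v s * q s) (1 + c) t0).
    - intros s. auto_derive; [split; [eexists; apply Hx|split; [eexists; apply Hv|trivial]]|].
      change (Derive (fun s => x s) s) with (Derive x s).
      change (Derive (fun s => v s) s) with (Derive v s).
      rewrite (is_derive_unique _ _ _ (Hx s)), (is_derive_unique _ _ _ (Hv s)). ring.
    - intros s. pose proof (pow2_ge_0 (x s - p)). pose proof (pow2_ge_0 (v s)). lra.
    - intros s. apply Rle_trans with (1 := Rabs_triang _ _).
      rewrite !Rabs_mult, (Rabs_pos_eq 2) by lra.
      rewrite <- (pow2_abs (x s - p)), <- (pow2_abs (v s)).
      specialize (Hq s).
      pose proof (Rabs_pos (x s - p)). pose proof (Rabs_pos (v s)).
      set (X := Rabs (x s - p)) in *. set (Y := Rabs (v s)) in *.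
      assert (2 * Y * Rabs (q s) <= 2 * Y * (c * X)) by (apply Rmult_le_compat_l; lra).
      assert (0 <= (1 + c) * (X - Y) ^ 2) by (apply Rmult_le_pos; [lra|apply pow2_ge_0]).
      nra.
    - rewrite Hx0, Hv0. ring. }
  pose proof (pow2_ge_0 (x t - p)). pose proof (pow2_ge_0 (v t)). nra.
Qed.

(** A negative slope would push a convex function above [hi] far to the left, so [x] is
    nondecreasing. If it never came below [lo + e], the slope would grow at rate at least [mu],
    hence be negative early on. *)
Lemma convex_bounded_limit (x v q : R -> R) T0 lo hi :
  (forall t, is_derive x t (v t)) -> (forall t, is_derive v t (q t)) ->
  (forall t, t <= T0 -> lo <= x t <= hi) ->
  (forall t, t <= T0 -> 0 <= q t) ->
  (forall e, 0 < e -> exists mu, 0 < mu /\ forall t, t <= T0 -> lo + e <= x t -> mu <= q t) ->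
  forall e, 0 < e -> exists T, forall t, t <= T -> x t < lo + e.
Proof.
  intros Hx Hv Hb Hq Hmu e He.
  assert (Haff : forall k z, is_derive (fun s : R => k * s) z k).
  { intros k z. auto_derive; trivial; ring. }
  assert (Hv0 : forall t, t <= T0 -> 0 <= v t).
  { intros t Ht. apply Rnot_lt_le. intros Hneg.
    assert (Hvle : forall s, s <= t -> v s <= v t).
    { intros s Hs. assert (0 * t - 0 * s <= v t - v s); [|lra].
      apply (increment_le (fun s => 0 * s) (fun _ => 0) v q); auto.
      intros z Hz. apply Hq. lra. }
    set (s := t - (hi - lo + 1) / - v t).
    assert (Hhl : lo <= hi) by (specialize (Hb t Ht); lra).
    assert (Hd : 0 < (hi - lo + 1) / - v t) by (apply Rdiv_lt_0_compat; lra).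
    assert (Hs : s <= t) by (unfold s; lra).
    assert (x t - x s <= v t * t - v t * s).
    { apply (increment_le x v (fun s => v t * s) (fun _ => v t)); auto.
      intros z Hz. apply Hvle. lra. }
    assert (v t * t - v t * s = - (hi - lo + 1)) by (unfold s; field; lra).
    pose proof (Hb t Ht). pose proof (Hb s ltac:(lra)). lra. }
  assert (Hex : exists T, T <= T0 /\ x T < lo + e).
  { apply NNPP. intros Hn. destruct (Hmu e He) as [mu [Hmu0 Hmuq]].
    set (s := T0 - (v T0 + 1) / mu).
    pose proof (Hv0 T0 ltac:(lra)).
    assert (0 < (v T0 + 1) / mu) by (apply Rdiv_lt_0_compat; lra).
    assert (Hs : s <= T0) by (unfold s; lra).
    assert (mu * T0 - mu * s <= v T0 - v s).
    { apply (increment_le (fun s => mu * s) (fun _ => mu) v q); auto.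
      intros z Hz. apply Hmuq; [lra|]. apply Rnot_lt_le. intros Hlt. apply Hn.
      exists z. split; [lra|assumption]. }
    assert (mu * T0 - mu * s = v T0 + 1) by (unfold s; field; lra).
    pose proof (Hv0 s Hs). lra. }
  destruct Hex as [T [HT HxT]]. exists T. intros t Ht.
  assert (0 * T - 0 * t <= x T - x t); [|lra].
  apply (increment_le (fun s => 0 * s) (fun _ => 0) x v); auto.
  intros z Hz. apply Hv0. lra.
Qed.

Lemma sign_near_zero (f : R -> R) p l :
  is_derive f p l -> 0 < l -> f p = 0 ->
  exists d, 0 < d /\ forall z, Rabs (z - p) < d ->
    (p < z -> 0 < f z) /\ (z < p -> f z < 0).
Proof.
  intros Hf Hl Hp. apply is_derive_Reals in Hf.
  destruct (Hf l Hl) as [d Hd]. exists d. split; [apply cond_pos|].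
  intros z Hz.
  assert (H : z <> p -> 0 < (f z - f p) / (z - p)).
  { intros Hzp. specialize (Hd (z - p) ltac:(lra) Hz).
    replace (p + (z - p)) with z in Hd by ring. apply Rabs_lt_between' in Hd. lra. }
  rewrite Hp, Rminus_0_r in H. split; intros Hlt; specialize (H ltac:(lra)).
  - replace (f z) with (f z / (z - p) * (z - p)) by (field; lra).
    apply Rmult_lt_0_compat; lra.
  - replace (f z) with (- (f z / (z - p) * (p - z))) by (field; lra).
    assert (0 < f z / (z - p) * (p - z)) by (apply Rmult_lt_0_compat; lra). lra.
Qed.

Lemma positive_lower_bound (f : R -> R) a b :
  a <= b -> (forall z, continuous f z) -> (forall z, a <= z <= b -> 0 < f z) ->
  exists m, 0 < m /\ forall z, a <= z <= b -> m <= f z.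
Proof.
  intros Hab Hc Hf.
  destruct (continuity_ab_min f a b Hab) as [z0 [Hmin Hz0]].
  - intros z _. apply continuity_pt_filterlim, Hc.
  - exists (f z0). split; [now apply Hf|exact Hmin].
Qed.

(** * Localised minimisers *)

(** [W] is the signed distance from [-1] in the degenerate Jacobi metric [sqrt (2 * V)]; by the last
    clause, thin collars at the wells are cheap to cross. *)
Lemma transition_cost_exists (V : R -> R) :
  (forall x, continuous V x) -> (forall x, 0 <= V x) ->
  (forall x, -1 < x < 1 -> 0 < V x) ->
  exists W, (forall x, is_derive W x (sqrt (2 * V x))) /\ W (-1) = 0 /\
    (forall y z, y <= z -> W y <= W z) /\
    (forall y z, -1 <= y -> y < z -> z <= 1 -> W y < W z) /\
    (forall d, 0 < d -> exists rho, 0 < rho < 1 /\ W (-1 + rho) <= d /\ W 1 - W (1 - rho) <= d).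
Proof.
  intros Hc HV HVpos.
  set (g := fun x => sqrt (2 * V x)).
  assert (Hg : forall x, continuous g x).
  { intros x. apply (continuous_comp (fun x => 2 * V x) sqrt).
    - apply (continuous_mult (fun _ => 2) V); [apply continuous_const|apply Hc].
    - apply continuous_sqrt. }
  set (W := fun x => RInt g (-1) x).
  assert (HW : forall x, is_derive W x (g x)).
  { intros x. apply is_derive_RInt with (-1); [|apply Hg].
    exists (mkposreal 1 Rlt_0_1). intros y _. apply RInt_correct.
    apply ex_RInt_continuous. intros; apply Hg. }
  assert (Hzero : forall z, is_derive (fun _ : R => 0) z 0) by (intros; apply @is_derive_const).
  assert (Hmono : forall y z, y <= z -> W y <= W z).
  { intros y z Hyz. assert (0 - 0 <= W z - W y); [|lra].
    apply (increment_le (fun _ => 0) (fun _ => 0) W g); auto.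
    intros; apply sqrt_pos. }
  exists W. split; [exact HW|]. split; [exact (RInt_point (-1) g)|]. split; [exact Hmono|]. split.
  - intros y z Hy Hyz Hz.
    (* On the middle third the mean value point stays strictly inside [(-1,1)], where [V] is
       positive. *)
    set (y' := (2 * y + z) / 3). set (z' := (y + 2 * z) / 3).
    assert (y < y' /\ y' < z' /\ z' < z) by (unfold y', z'; lra).
    destruct (mean_value W g y' z' HW) as [c [Hcc Heq]].
    rewrite Rmin_left, Rmax_right in Hcc by lra.
    assert (0 < g c).
    { apply sqrt_lt_R0. specialize (HVpos c ltac:(lra)). lra. }
    assert (0 < g c * (z' - y')) by (apply Rmult_lt_0_compat; lra).
    assert (W y <= W y') by (apply Hmono; lra). assert (W z' <= W z) by (apply Hmono; lra).
    lra.
  - intros d Hd. destruct (continuous_bounded g (-1) 1 Hg) as [B [HB HgB]].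
    assert (HB1 : 0 < B + 1) by lra.
    assert (Hdiv : 0 < d / (B + 1)) by now apply Rdiv_lt_0_compat.
    set (rho := Rmin (1 / 2) (d / (B + 1))).
    assert (H1 : rho <= 1 / 2) by apply Rmin_l.
    assert (H2 : rho <= d / (B + 1)) by apply Rmin_r.
    assert (H0 : 0 < rho) by (apply Rmin_pos; lra).
    apply (Rle_div_r _ _ _ HB1) in H2.
    assert (Hinc : forall y, -1 <= y -> y + rho <= 1 -> W (y + rho) - W y <= d).
    { intros y Hy1 Hy2. destruct (mean_value W g y (y + rho) HW) as [c [Hcc ->]].
      rewrite Rmin_left, Rmax_right in Hcc by lra.
      specialize (HgB c ltac:(lra)). apply Rabs_le_between in HgB. nra. }
    exists rho. split; [lra|]. split.
    + specialize (Hinc (-1) ltac:(lra) ltac:(lra)).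
      replace (W (-1)) with 0 in Hinc by (symmetry; exact (RInt_point (-1) g)). lra.
    + specialize (Hinc (1 - rho) ltac:(lra) ltac:(lra)).
      replace (1 - rho + rho) with 1 in Hinc by ring. exact Hinc.
Qed.

Lemma localized_minimizers (V a : R -> R) a1 rho' :
  (forall x, ex_derive V x) -> (forall x, continuous (Derive V) x) ->
  (forall x, 0 <= V x) -> V (-1) = 0 -> V 1 = 0 -> (forall x, -1 < x < 1 -> 0 < V x) ->
  continuous a 0 -> 0 < a 0 -> (forall t, a 0 <= a t) -> a 0 < a1 ->
  (exists M, forall t, M <= Rabs t -> a1 <= a t) -> 0 < rho' < 1 ->
  exists eps_star, 0 < eps_star /\ forall eps, 0 < eps < eps_star ->
  exists n0 S0 X, forall n, (n0 <= n)%nat ->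
    (forall i, -1 <= X n i <= 1) /\
    (forall i, (S i < 2 * grid_half n)%nat ->
       X n (S (S i)) - 2 * X n (S i) + X n i
         = grid_step n ^ 2 * (a (eps * grid_time n (S i)) * Derive V (X n (S i)))) /\
    (forall i, grid_time n i <= - S0 -> X n i <= -1 + rho') /\
    (forall i, (i <= 2 * grid_half n)%nat -> S0 <= grid_time n i -> 1 - rho' <= X n i).
Proof.
  intros HdV HcV HV HV1 HV2 HVpos Hca Ha0 Hinf Ha1 [M HM] Hrho'.
  assert (HVc : forall x, continuous V x) by (intros; apply (ex_derive_continuous V), HdV).
  destruct (transition_cost_exists V HVc HV HVpos) as [W [HW [HW0 [HWm [HWs HWd]]]]].
  set (s0 := sqrt (a 0)). set (s1 := sqrt a1). set (w := W 1).
  assert (Hs0 : 0 < s0) by now apply sqrt_lt_R0.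
  assert (Hs01 : s0 < s1) by (apply sqrt_lt_1_alt; lra).
  assert (Hw : 0 < w) by (rewrite <- HW0; apply HWs; lra).
  (* The least cost, per unit of [sqrt a], of going from a well to distance [rho'] from it: the
     surplus paid by a path that has to start again. *)
  set (kappa := Rmin (W (-1 + rho')) (w - W (1 - rho'))).
  assert (Hk : 0 < kappa).
  { apply Rmin_pos.
    - rewrite <- HW0. apply HWs; lra.
    - assert (W (1 - rho') < W 1) by (apply HWs; lra). unfold w. lra. }
  assert (Hk1 : kappa <= W (-1 + rho')) by apply Rmin_l.
  assert (Hk2 : kappa <= w - W (1 - rho')) by apply Rmin_r.
  (* [P] dominates the coefficients of [d] in [HE1] and [HE2], which thus reduce to the two strict
     gaps at [d = 0]. *)
  set (P := 4 * s0 + 3 * s1 + w + 2).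
  assert (HP : 0 < P) by (unfold P; lra).
  assert (Hgap : exists d, 0 < d /\ d <= 1 /\ d * P < s0 * kappa /\ d * P < (s1 - s0) * w).
  { assert (H1 : 0 < s0 * kappa) by now apply Rmult_lt_0_compat.
    assert (H2 : 0 < (s1 - s0) * w) by (apply Rmult_lt_0_compat; lra).
    assert (HP2 : 0 < 2 * P) by lra.
    set (mm := Rmin (s0 * kappa) ((s1 - s0) * w)).
    assert (Hmm : 0 < mm) by now apply Rmin_pos.
    assert (Hm1 : mm <= s0 * kappa) by apply Rmin_l.
    assert (Hm2 : mm <= (s1 - s0) * w) by apply Rmin_r.
    exists (Rmin 1 (mm / (2 * P))).
    assert (Hd := Rmin_r 1 (mm / (2 * P))). apply (Rle_div_r _ _ _ HP2) in Hd.
    split; [apply Rmin_pos; [lra|now apply Rdiv_lt_0_compat]|].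
    split; [apply Rmin_l|]. lra. }
  destruct Hgap as [d [Hd [Hd1 [Hgap1 Hgap2]]]].
  set (E := (s0 + d) * (w + d) + d).
  assert (HE0 : E <= s0 * w + d * (s0 + w + 2)).
  { unfold E. nra. }
  (* One [d] pays for the collar of width [rho], one for the calibration losses of up to
     [4 * (d / 4)], and one for the grid error [C1 * h * E]. *)
  assert (HE1 : E < s0 * (kappa + w - 3 * d)) by (unfold P in Hgap1; nra).
  assert (HE2 : E < s1 * (w - 3 * d)) by (unfold P in Hgap2; nra).
  assert (HEpos : 0 < E).
  { assert (0 < (s0 + d) * (w + d)) by (apply Rmult_lt_0_compat; lra). unfold E. lra. }
  destruct (HWd d Hd) as [rho [Hrho [HWr1 HWr2]]]. fold w in HWr2.
  assert (Hm : exists m, 0 < m /\ forall y, -1 + rho <= y <= 1 - rho -> m <= V y).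
  { destruct (Rle_lt_dec (-1 + rho) (1 - rho)) as [Hr|Hr].
    - apply positive_lower_bound; auto. intros z Hz. apply HVpos. lra.
    - exists 1. split; [lra|]. intros; lra. }
  destruct Hm as [m [Hm HmV]].
  assert (Hs : 0 < d / 4) by lra.
  destruct (action_lower_bound V W (d / 4) HdV HcV HV HW Hs) as [C1 [HC1 Hlow]].
  assert (HA : 0 < (s0 + d) ^ 2) by (apply pow_lt; lra).
  destruct (action_upper_bound V W (d / 4) ((s0 + d) ^ 2) HdV HcV HV HV1 HV2 HW Hs HA)
    as [C2 [L [HC2 [HL Hup]]]].
  rewrite sqrt_pow2 in Hup by lra.
  assert (Hdel : exists del, 0 < del /\ forall t, Rabs t < del -> a t <= (s0 + d) ^ 2).
  { assert (Hsq : s0 ^ 2 = a 0) by (apply pow2_sqrt; lra).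
    assert (Hpos : 0 < (s0 + d) ^ 2 - a 0) by (rewrite <- Hsq; nra).
    destruct (proj1 (filterlim_locally _ _) Hca (mkposreal _ Hpos)) as [del Hdel].
    exists del. split; [apply cond_pos|]. intros t Ht.
    assert (Hb : Rabs (a t - a 0) < (s0 + d) ^ 2 - a 0).
    { apply (Hdel t). unfold ball; simpl; unfold AbsRing_ball, abs, minus, plus, opp; simpl.
      now rewrite Ropp_0, Rplus_0_r. }
    apply Rabs_lt_between in Hb. lra. }
  destruct Hdel as [del [Hdel Hadel]].
  (* The competitor moves only during the times between [0] and [L], where [eps * t] must stay below
     [del]. *)
  exists (del / (L + 1)). split; [apply Rdiv_lt_0_compat; lra|].
  intros eps [Heps1 Heps2].
  assert (HL1 : 0 < L + 1) by lra. apply (Rlt_div_r _ _ _ HL1) in Heps2.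
  set (r := Rabs M / eps).
  assert (Hr : 0 <= r) by (apply Rdiv_le_0_compat; [apply Rabs_pos|assumption]).
  assert (Hfar : forall t, r <= Rabs t -> a1 <= a (eps * t)).
  { intros t Ht. apply HM. rewrite Rabs_mult, (Rabs_pos_eq eps) by lra.
    apply (Rle_div_l _ _ _ Heps1) in Ht. pose proof (Rle_abs M). lra. }
  assert (Ham : 0 < a 0 * m) by now apply Rmult_lt_0_compat.
  destruct (nfloor_ex (E / (a 0 * m))) as [p [_ Hp]].
  { apply Rdiv_le_0_compat; lra. }
  rewrite <- S_INR in Hp. set (pp := S p) in *.
  apply (Rlt_div_l _ _ _ Ham) in Hp.
  assert (Hmin : forall n, exists x, admissible (2 * grid_half n) x /\
    forall y, admissible (2 * grid_half n) y ->
      action (grid_step n) (fun i => a (eps * grid_time n i)) V x (2 * grid_half n)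
      <= action (grid_step n) (fun i => a (eps * grid_time n i)) V y (2 * grid_half n)).
  { intros n. apply minimizer_exists; auto.
    - apply grid_step_pos.
    - intros i. specialize (Hinf (eps * grid_time n i)). lra.
    - unfold grid_half. lia. }
  apply choice in Hmin. destruct Hmin as [X HX].
  assert (HC2' : 0 < d / (C2 + 1)) by (apply Rdiv_lt_0_compat; lra).
  assert (HCE : 0 < C1 * E + 1) by (pose proof (Rmult_le_pos _ _ HC1 (Rlt_le _ _ HEpos)); lra).
  assert (HC1' : 0 < d / (C1 * E + 1)) by (apply Rdiv_lt_0_compat; lra).
  destruct (eventually_grid 0 L (Rmin (d / (C2 + 1)) (d / (C1 * E + 1))))
    as [n0 Hn0]; [now apply Rmin_pos|].
  (* Beyond [r] the coefficient is at least [a1], and [pp] time units in the middle region exceed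
     the budget. Localisation needs those [pp] units inside the region beyond [r]. *)
  exists n0, (r + INR pp), X. intros n Hn.
  destruct (Hn0 n Hn) as [_ [HLn Hhn]].
  assert (Hh1 := Rlt_le_trans _ _ _ Hhn (Rmin_l _ _)).
  assert (Hh2 := Rlt_le_trans _ _ _ Hhn (Rmin_r _ _)).
  assert (HC21 : 0 < C2 + 1) by lra.
  apply (Rlt_div_r _ _ _ HC21) in Hh1. apply (Rlt_div_r _ _ _ HCE) in Hh2.
  assert (Hh := grid_step_pos n).
  destruct (HX n) as [HXa HXm]. set (b := fun i => a (eps * grid_time n i)) in *.
  set (N := (2 * grid_half n)%nat) in *.
  assert (Hb : forall j, a 0 <= b j) by (intros; apply Hinf).
  assert (Hb0 : forall j, 0 <= b j) by (intros j; specialize (Hb j); lra).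
  assert (Hnn : INR (S n) * grid_step n = 1).
  { unfold grid_step. apply Rinv_r, not_0_INR. lia. }
  assert (Hhalf : INR (grid_half n) * grid_step n = INR (S n)).
  { unfold grid_half. rewrite mult_INR, Rmult_assoc, Hnn. ring. }
  assert (Hk0 : grid_time n (grid_half n) = 0) by (unfold grid_time; ring).
  assert (HE : action (grid_step n) b V (X n) N <= E).
  { destruct (Hup (grid_step n) b (grid_half n) N Hh Hb0) as [y [Hy1 Hy2]].
    - intros i Hi HiL. rewrite grid_time_diff, Hk0, Rminus_0_r in HiL by assumption.
      apply Hadel. rewrite Rabs_pos_eq.
      + apply Rle_lt_trans with (2 := Heps2). apply Rmult_le_compat_l; lra.
      + apply Rmult_le_pos; [lra|].
        generalize (grid_time_diff n _ _ Hi) (Rmult_le_pos _ _ (pos_INR (i - grid_half n))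
          (Rlt_le _ _ Hh)). lra.
    - unfold N. lia.
    - replace (N - grid_half n)%nat with (grid_half n) by (unfold N; lia).
      rewrite Hhalf. lra.
    - apply Rle_trans with (1 := HXm y Hy1). apply Rle_trans with (1 := Hy2).
      fold w. rewrite HW0. unfold E.
      assert ((s0 + d) * (w - 0 + 2 * (d / 4)) <= (s0 + d) * (w + d)).
      { apply Rmult_le_compat_l; lra. }
      assert (C2 * grid_step n <= d) by lra. lra. }
  assert (HXi := proj2 (proj2 HXa)).
  assert (Hlow' : forall beta i j, 0 <= beta -> (i <= j)%nat ->
    (forall l, (i <= l < j)%nat -> beta <= b l) ->
    sqrt beta * (W (X n j) - W (X n i) - 2 * (d / 4) - C1 * grid_step n *
      (action (grid_step n) b V (X n) j - action (grid_step n) b V (X n) i))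
    <= action (grid_step n) b V (X n) j - action (grid_step n) b V (X n) i).
  { intros beta i j Hbeta Hij Hbl. now apply Hlow. }
  assert (Herr : C1 * grid_step n * E <= d) by lra.
  set (nn := (pp * S n)%nat).
  assert (Hnnh : INR nn * grid_step n = INR pp).
  { unfold nn. rewrite mult_INR, Rmult_assoc, Hnn. ring. }
  assert (Hpp : 0 <= INR pp) by apply pos_INR.
  assert (HEn : E < INR nn * grid_step n * (a 0 * m)) by (rewrite Hnnh; lra).
  split; [exact HXi|]. split; [|split].
  - intros i Hi. apply (discrete_euler_lagrange _ b V (X n) N); auto.
  - intros i Hi. left.
    assert (Hti : grid_time n (i + nn) = grid_time n i + INR pp).
    { generalize (grid_time_diff n i (i + nn) ltac:(lia)).
      replace (i + nn - i)%nat with nn by lia. rewrite Hnnh. lra. }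
    apply (localization_left V W C1 (d / 4) (grid_step n) b (X n) N E (a 0) a1
             rho rho' m i nn); auto; try lra.
    + assert (i + nn <= grid_half n)%nat by (apply (grid_time_le n); lra). unfold N. lia.
    + intros j Hj. apply Hfar.
      generalize (grid_time_diff n j (i + nn) ltac:(lia)) (Rmult_le_pos _ _
        (pos_INR (i + nn - j)) (Rlt_le _ _ Hh)). intros Hj1 Hj2.
      rewrite Rabs_left1 by lra. lra.
    + fold s0. apply Rlt_le_trans with (1 := HE1). apply Rmult_le_compat_l; [lra|].
      fold w. lra.
    + fold s1. apply Rlt_le_trans with (1 := HE2). apply Rmult_le_compat_l; [lra|]. lra.
  - intros i HiN Hi. left.
    assert (Hi0 : (nn <= i)%nat).
    { apply INR_le. apply (Rmult_le_reg_r (grid_step n)); [assumption|]. rewrite Hnnh.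
      unfold grid_time in Hi. rewrite Rmult_minus_distr_r, Hhalf in Hi.
      pose proof (pos_INR (S n)). lra. }
    assert (Hti : grid_time n (i - nn) = grid_time n i - INR pp).
    { generalize (grid_time_diff n (i - nn) i ltac:(lia)).
      replace (i - (i - nn))%nat with nn by lia. rewrite Hnnh. lra. }
    replace i with ((i - nn) + nn)%nat by lia.
    apply (localization_right V W C1 (d / 4) (grid_step n) b (X n) N E (a 0) a1
             rho rho' m (i - nn) nn); auto; try lra.
    + unfold N. lia.
    + intros j Hj. apply Hfar.
      generalize (grid_time_diff n (i - nn) j ltac:(lia)) (Rmult_le_pos _ _
        (pos_INR (j - (i - nn))) (Rlt_le _ _ Hh)). intros Hj1 Hj2.
      rewrite Rabs_pos_eq by lra. lra.
    + fold s0. apply Rlt_le_trans with (1 := HE1). apply Rmult_le_compat_l; [lra|].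
      fold w. lra.
    + fold s1. apply Rlt_le_trans with (1 := HE2). apply Rmult_le_compat_l; [lra|].
      fold w. lra.
Qed.

(** * Heteroclinic solution *)

Lemma limit_in_convex_well (V b x v : R -> R) beta T0 r :
  (forall z, ex_derive V z) -> (forall z, continuous (Derive V) z) -> 0 < beta ->
  (forall t, beta <= b t) -> 0 < r ->
  (forall z, -1 < z <= -1 + r -> 0 < Derive V z) -> Derive V (-1) = 0 ->
  (forall t, is_derive x t (v t)) -> (forall t, is_derive v t (b t * Derive V (x t))) ->
  (forall t, t <= T0 -> -1 <= x t <= -1 + r) ->
  forall e, 0 < e -> exists T, forall t, t <= T -> x t < -1 + e.
Proof.
  intros Hd Hc Hbeta Hb Hr Hpos Hcrit Hx Hv Hloc.
  apply (convex_bounded_limit x v (fun t => b t * Derive V (x t)) T0 (-1) (-1 + r)); auto.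
  - intros t Ht. specialize (Hloc t Ht). specialize (Hb t). apply Rmult_le_pos; [lra|].
    destruct (Req_dec (x t) (-1)) as [->|Hne]; [lra|]. left. apply Hpos. lra.
  - intros e He.
    (* [Rmin] keeps the interval nonempty when [e] exceeds [r]. *)
    destruct (positive_lower_bound (Derive V) (-1 + Rmin e r) (-1 + r)) as [nu [Hnu Hmin]].
    + pose proof (Rmin_r e r). lra.
    + exact Hc.
    + intros z Hz. apply Hpos. pose proof (Rmin_pos e r He Hr). lra.
    + exists (beta * nu). split; [now apply Rmult_lt_0_compat|]. intros t Ht Hxt.
      specialize (Hloc t Ht). pose proof (Rmin_l e r).
      apply Rmult_le_compat; [lra|lra|apply Hb|]. apply Hmin. lra.
Qed.

Theorem theorem3p1 (V a : R -> R) (a_inf : R) :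
  C2 V ->
  (forall x, 0 <= V x) ->
  V (-1) = 0 -> V 1 = 0 ->
  (forall x, -1 < x < 1 -> 0 < V x) ->
  0 < Derive_n V 2 (-1) -> 0 < Derive_n V 2 1 ->
  bounded_fun a ->
  (forall t, continuous a t) ->
  liminf_abs_infty a a_inf ->
  (forall t, a 0 <= a t) ->
  a 0 < a_inf ->
  0 < a 0 ->
  exists eps_star, 0 < eps_star /\
    forall eps, 0 < eps < eps_star ->
      exists x : R -> R,
        H1loc x /\ C2 x /\
        (forall t, Derive_n x 2 t = a (eps * t) * Derive V (x t)) /\
        is_lim x m_infty (-1) /\ is_lim x p_infty 1 /\
        (forall t, -1 < x t < 1).
Proof.
  intros HC2 HV HV1 HV2 HVpos Hdd1 Hdd2 [M HM] Hac [Hli _] Hinf Hgap Ha0.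
  assert (HdV : forall x, ex_derive V x) by (intros; apply HC2).
  assert (HddV : forall x, ex_derive (Derive V) x) by (intros; apply HC2).
  assert (HcV : forall x, continuous (Derive V) x).
  { intros x. apply (ex_derive_continuous (Derive V)), HddV. }
  assert (HcV2 : forall x, continuous (Derive (Derive V)) x) by (intros; apply HC2).
  assert (Hcrit : forall p, V p = 0 -> Derive V p = 0).
  { intros p Hp. apply (derive_eq0_at_min V p); [apply Derive_correct, HdV|].
    intros z. rewrite Hp. apply HV. }
  destruct (sign_near_zero (Derive V) (-1) _ (Derive_correct _ _ (HddV _)) Hdd1 (Hcrit _ HV1))
    as [r1 [Hr1 Hsg1]].
  destruct (sign_near_zero (Derive V) 1 _ (Derive_correct _ _ (HddV _)) Hdd2 (Hcrit _ HV2))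
    as [r2 [Hr2 Hsg2]].
  assert (Hr : exists r, 0 < r < 1 /\ r < r1 /\ r < r2).
  { exists (Rmin (1 / 2) (Rmin (r1 / 2) (r2 / 2))).
    pose proof (Rmin_l (1 / 2) (Rmin (r1 / 2) (r2 / 2))).
    pose proof (Rmin_r (1 / 2) (Rmin (r1 / 2) (r2 / 2))).
    pose proof (Rmin_l (r1 / 2) (r2 / 2)). pose proof (Rmin_r (r1 / 2) (r2 / 2)).
    assert (0 < Rmin (1 / 2) (Rmin (r1 / 2) (r2 / 2))) by (repeat apply Rmin_pos; lra).
    lra. }
  destruct Hr as [r [Hr01 [Hrr1 Hrr2]]].
  assert (Hfar : exists T, forall t, T <= Rabs t -> (a 0 + a_inf) / 2 <= a t).
  { destruct (Hli ((a_inf - a 0) / 2) ltac:(lra)) as [T HT]. exists T. intros t Ht.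
    specialize (HT t Ht). lra. }
  destruct (localized_minimizers V a ((a 0 + a_inf) / 2) r HdV HcV HV HV1 HV2 HVpos (Hac 0) Ha0
    Hinf ltac:(lra) Hfar Hr01) as [eps_star [Hes Hloc]].
  exists eps_star. split; [exact Hes|]. intros eps Heps.
  destruct (Hloc eps Heps) as [n0 [S0 [X HX]]].
  destruct (continuous_bounded (Derive V) (-1) 1 HcV) as [D1 [HD1 HD1b]].
  assert (HMpos : 0 <= M) by (specialize (HM 0); pose proof (Rabs_pos (a 0)); lra).
  destruct (continuum_limit (fun t => a (eps * t)) (Derive V) (M * D1) n0 X)
    as [x [v [Hx [Hv Hbox]]]].
  - intros t. apply (continuous_comp (fun t => eps * t) a); [|apply Hac].
    apply (continuous_mult (fun _ => eps) (fun t => t));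
      [apply continuous_const|apply continuous_id].
  - exact HcV.
  - now apply Rmult_le_pos.
  - intros t z Hz. rewrite Rabs_mult. apply Rmult_le_compat; auto using Rabs_pos.
  - intros n i Hn. now apply HX.
  - intros n i Hn Hi. now apply HX.
  - assert (Hx1 : forall t, -1 <= x t <= 1).
    { intros t. apply Hbox. exists n0. intros n Hn. now apply HX. }
    assert (HxL : forall t, t <= - S0 -> -1 <= x t <= -1 + r).
    { intros t Ht. apply Hbox. generalize (eventually_grid n0 (Rabs t) 1 Rlt_0_1).
      apply filter_imp. intros n [Hn [Hnt _]]. split; [now apply HX|].
      apply (HX n Hn). destruct (grid_index_time n t); [|lra].
      pose proof (Rle_abs (- t)). rewrite Rabs_Ropp in *. lra. }
    (* [grid_index] rounds down, so the sampled time may precede [t] by almost a step; the extra [1]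
       compensates. On the left, rounding down is harmless. *)
    assert (HxR : forall t, S0 + 1 <= t -> 1 - r <= x t <= 1).
    { intros t Ht. apply Hbox. generalize (eventually_grid n0 (Rabs t) 1 Rlt_0_1).
      apply filter_imp. intros n [Hn [Hnt Hh]]. split; [|now apply HX].
      pose proof (Rle_abs (- t)). pose proof (Rle_abs t). rewrite Rabs_Ropp in *.
      destruct (grid_index_time n t) as [Hg1 Hg2]; [lra|].
      apply (HX n Hn); [|lra].
      assert (grid_index n t + 2 * S n <= 2 * grid_half n)%nat; [|lia].
      apply grid_room. lra. }
    assert (HDx : forall t, Derive x t = v t) by (intros; now apply is_derive_unique).
    assert (HDDx : forall t, Derive_n x 2 t = a (eps * t) * Derive V (x t)).
    { intros t. simpl. rewrite (Derive_ext _ v) by exact HDx. now apply is_derive_unique. }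
    assert (Hxc : forall t, continuous x t).
    { intros t. apply (ex_derive_continuous x). eexists; apply Hx. }
    assert (Hvc : forall t, continuous v t).
    { intros t. apply (ex_derive_continuous v). eexists; apply Hv. }
    assert (Hlim1 : forall e, 0 < e -> exists T, forall t, t <= T -> x t < -1 + e).
    { apply (limit_in_convex_well V (fun t => a (eps * t)) x v (a 0) (- S0) r); auto; try lra.
      intros z Hz. apply Hsg1; [|lra]. rewrite Rabs_pos_eq; lra. }
    (* The reflection of both time and space carries the well at [1] to the one at [-1]; the
       velocity of [- x (- t)] is [v (- t)]. *)
    assert (Hlim2 : forall e, 0 < e -> exists T, forall t, T <= t -> 1 - e < x t).
    { intros e He.
      assert (HdVr : forall z, is_derive (fun z => V (- z)) z (- Derive V (- z))).
      { intros z. auto_derive; [apply HdV|].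
        change (Derive (fun y => V y)) with (Derive V). ring. }
      assert (HDVr : forall z, Derive (fun z => V (- z)) z = - Derive V (- z)).
      { intros z. apply is_derive_unique, HdVr. }
      destruct (limit_in_convex_well (fun z => V (- z)) (fun t => a (eps * - t))
        (fun t => - x (- t)) (fun t => v (- t)) (a 0) (- (S0 + 1)) r) with (e := e)
        as [T HT]; auto; try lra.
      - intros z. eexists; apply HdVr.
      - intros z. apply continuous_ext with (fun z => - Derive V (- z)).
        + intros y. symmetry. apply HDVr.
        + apply (continuous_opp (fun z => Derive V (- z))).
          apply (continuous_comp Ropp (Derive V)); [|apply HcV].
          apply (continuous_opp (fun z : R => z)), continuous_id.
      - intros z Hz. rewrite HDVr.
        assert (Derive V (- z) < 0); [|lra].
        apply Hsg2; [|lra]. rewrite Rabs_left1; lra.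
      - rewrite HDVr. replace (- -1) with 1 by ring. rewrite (Hcrit _ HV2). ring.
      - intros t. auto_derive; [eexists; apply Hx|].
        change (Derive (fun s => x s) (- t)) with (Derive x (- t)). rewrite HDx. ring.
      - intros t. cbv beta. rewrite HDVr, Ropp_involutive.
        replace (a (eps * - t) * - Derive V (x (- t)))
          with (scal (-1) (a (eps * - t) * Derive V (x (- t))))
          by (unfold scal; simpl; unfold mult; simpl; ring).
        apply (is_derive_comp v Ropp); [apply Hv|]. auto_derive; trivial; ring.
      - intros t Ht. specialize (HxR (- t) ltac:(lra)). lra.
      - exists (- T). intros t Ht. specialize (HT (- t) ltac:(lra)). cbv beta in HT.
        rewrite Ropp_involutive in HT. lra. }
    assert (Hnot : forall p t0, V p = 0 -> -1 <= p <= 1 -> x t0 = p -> v t0 = 0 ->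
      forall t, x t = p).
    { intros p t0 Hp Hp1 Hxp Hvp.
      destruct (lipschitz_on (Derive V) (-1) 1 HddV HcV2) as [K [HK HL]].
      apply (equilibrium_unique x v (fun t => a (eps * t) * Derive V (x t)) p (M * K) t0);
        auto; [|now apply Rmult_le_pos].
      intros t. rewrite Rabs_mult, Rmult_assoc.
      apply Rmult_le_compat; try apply Rabs_pos; [apply HM|].
      specialize (HL p (x t) Hp1 (Hx1 t)). rewrite (Hcrit p Hp), Rminus_0_r in HL. exact HL. }
    exists x. split; [|split; [|split; [exact HDDx|split; [|split]]]].
    + assert (Hsq : forall z : R, z * z = z ^ 2) by (intros; ring).
      intros t1 t2. split.
      * apply (ex_RInt_continuous (fun t => x t ^ 2)). intros t _.
        apply continuous_ext with (fun t => x t * x t); [intros; apply Hsq|].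
        apply (continuous_mult x x); apply Hxc.
      * apply (ex_RInt_continuous (fun t => Derive x t ^ 2)). intros t _.
        apply continuous_ext with (fun t => v t * v t); [intros y; rewrite HDx; apply Hsq|].
        apply (continuous_mult v v); apply Hvc.
    + intros t. split; [eexists; apply Hx|]. split.
      * apply ex_derive_ext with v; [intros; symmetry; apply HDx|]. eexists; apply Hv.
      * apply continuous_ext with (fun t => a (eps * t) * Derive V (x t));
          [intros; symmetry; apply HDDx|].
        apply (continuous_mult (fun t => a (eps * t)) (fun t => Derive V (x t))).
        -- apply (continuous_comp (fun t => eps * t) a); [|apply Hac].
           apply (continuous_mult (fun _ => eps) (fun t => t));
             [apply continuous_const|apply continuous_id].
        -- apply (continuous_comp x (Derive V)); [apply Hxc|apply HcV].
    + apply is_lim_spec. intros e. simpl.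
      destruct (Hlim1 e (cond_pos e)) as [T HT]. exists T. intros t Ht.
      specialize (HT t ltac:(lra)). specialize (Hx1 t). apply Rabs_lt_between'.
      pose proof (cond_pos e). lra.
    + apply is_lim_spec. intros e. simpl.
      destruct (Hlim2 e (cond_pos e)) as [T HT]. exists T. intros t Ht.
      specialize (HT t ltac:(lra)). specialize (Hx1 t). apply Rabs_lt_between'.
      pose proof (cond_pos e). lra.
    (* A contact is an extremum of [x], so the velocity vanishes and [Hnot] makes [x] constant; its
       value beyond the opposite end of the time window contradicts this. *)
    + assert (Hcontact : forall t0, (x t0 = 1 \/ x t0 = -1) -> v t0 = 0).
      { intros t0 [H0|H0].
        - assert (- v t0 = 0); [|lra].
          apply (derive_eq0_at_min (fun t => - x t) t0).
          + apply (is_derive_opp x), Hx.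
          + intros z. specialize (Hx1 z). lra.
        - apply (derive_eq0_at_min x t0); [apply Hx|].
          intros z. specialize (Hx1 z). lra. }
      intros t. specialize (Hx1 t). split; apply Rnot_le_lt; intros Hle.
      * assert (H0 : x t = -1) by lra.
        assert (H1 := Hnot (-1) t HV1 ltac:(lra) H0 (Hcontact t (or_intror H0)) (S0 + 1)).
        specialize (HxR (S0 + 1) ltac:(lra)). lra.
      * assert (H0 : x t = 1) by lra.
        assert (H1 := Hnot 1 t HV2 ltac:(lra) H0 (Hcontact t (or_introl H0)) (- S0)).
        specialize (HxL (- S0) ltac:(lra)). lra.
Qed.
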